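(* Let $d\ge1$, $k\in\{0,1,\dots,d-1\}$, $\gamma\in(0,\infty)$, let $\mathbb{Q}$ be a probability measure on $\mathbb{M}_{d,k}=\mathrm{SO}_{d,k}\times\mathcal{C}_{d-k}'$, let $\eta$ be a Poisson process in $\mathbb{R}^{d-k}\times\mathbb{M}_{d,k}$ with intensity measure $\gamma\,\ell_{d-k}\otimes\mathbb{Q}$, and let $$Z:=\bigcup_{(x,\theta,K)\in\eta}Z(x,\theta,K),\qquad Z(x,\theta,K):=\theta\big((x+K)\times E_k\big),$$ be the associated Poisson cylinder model. Suppose that the typical cylinder base $\Xi$ satisfies $\ell_{d-k}(\Xi)\le A$ $\mathbb{P}$-almost surely for some $A<\infty$. Let $W\subset\mathbb{R}^d$ be a non-empty compact set and put $F:=\ell_d(Z\cap W)$. Then $$\mathbb{P}(F\ge\mathbb{E}[F]+t)\le\exp\Big\{-\frac{c\,t^2}{A\,\mathrm{diam}(W)^k\,\ell_d(W)}\Big\},$$ $$\mathbb{P}(F\le\mathbb{E}[F]-t)\le\exp\Big\{-\frac{c\,t^2}{\gamma\,A^2\,\mathrm{diam}(W)^k\,\ell_d(W)}\Big\}$$ for every $t\ge4\sqrt{\kappa}$, where $c=\log(2)/(8\kappa)$ and $\kappa=\frac{\sqrt{e}}{2(\sqrt{e}-1)}$.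
   Context: $e_1,\dots,e_d$ is the standard orthonormal basis of $\mathbb{R}^d$, $E_k:=\mathrm{span}(e_{d-k+1},\dots,e_d)$, and $\mathbb{R}^{d-k}$ is identified with $\mathrm{span}(e_1,\dots,e_{d-k})\subset\mathbb{R}^d$. $G(d,k)$ is the Grassmannian of $k$-dimensional linear subspaces of $\mathbb{R}^d$. For $L\in G(d,k)$ let $\mathbf{M}_L$ be the set of matrices $M\in\mathrm{SO}(d)$ with $L=ME_k$, let $\mathrm{lex\,min}\,\mathbf{M}_L$ be its lexicographically smallest element, and put $\mathrm{SO}_{d,k}:=\{\mathrm{lex\,min}\,\mathbf{M}_L:L\in G(d,k)\}$. $\mathcal{C}_{d-k}'$ is the space of non-empty compact subsets of $\mathbb{R}^{d-k}$, and $\mathbb{M}_{d,k}:=\mathrm{SO}_{d,k}\times\mathcal{C}_{d-k}'$. $\ell_m$ is Lebesgue measure on $\mathbb{R}^m$, and $\mathrm{diam}(W)$ is the diameter of $W$. The typical cylinder base $\Xi$ is a random element of $\mathcal{C}_{d-k}'$ whose distribution is the marginal of $\mathbb{Q}$ on the $\mathcal{C}_{d-k}'$-coordinate. A Poisson process $\eta$ on a measurable space with $\sigma$-finite intensity measure $\nu$ is a random counting measure, defined on a probability space $(\Omega,\mathcal{F},\mathbb{P})$, such that $\eta(B)$ is Poisson distributed with mean $\nu(B)$ for each measurable $B$, and $\eta(B_1),\dots,\eta(B_n)$ are independent for pairwise disjoint measurable $B_1,\dots,B_n$; $(x,\theta,K)\in\eta$ means that $(x,\theta,K)$ is a point (atom)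 of $\eta$. The space $\mathcal{C}_{d-k}'$ carries the Borel $\sigma$-field of the Hausdorff metric, $\mathrm{SO}_{d,k}$ the Borel $\sigma$-field inherited from $\mathrm{SO}(d)$, and product spaces the product $\sigma$-field. *)

(* Defs.v *)
From HB Require Import structures.
From mathcomp Require Import all_boot all_order all_algebra.
From mathcomp Require Import all_classical all_reals all_analysis.
From mathcomp Require Import measurable_realfun.

Set Implicit Arguments.
Unset Strict Implicit.
Unset Printing Implicit Defensive.

Import Order.TTheory GRing.Theory Num.Theory.
Import numFieldNormedType.Exports.

Local Open Scope classical_set_scope.
Local Open Scope ring_scope.

(* A vector of R^m is a column 'cV[R]_m, so that matrices act by left
   multiplication. The library norm on matrices is the sup norm: it gives the
   usual topology (hence the usual open, compact and Borel sets), but not the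
   Euclidean distance, for which [enorm] is used. The codimension parameter k
   ranges over 'I_d, i.e. over {0, ..., d - 1}, which forces d >= 1. *)

Section Borel_matrix.
Variable R : realType.

HB.instance Definition _ (m n : nat) :=
  @isMeasurable.Build (sigma_display (@open 'M[R]_(m, n))) 'M[R]_(m, n)
    <<s (@open 'M[R]_(m, n)) >>
    (@sigma_algebra0 _ setT (@open 'M[R]_(m, n)))
    (@sigma_algebraC _ (@open 'M[R]_(m, n)))
    (@sigma_algebra_bigcup _ setT (@open 'M[R]_(m, n))).

Let ratmx_box m n (q : 'M[rat]_(m, n) * nat) : set 'M[R]_(m, n) :=
  [set M | forall i j, `|ratr (q.1 i j) - M i j| < q.2.+1%:R^-1].

Let open_ratmx_box m n (U : set 'M[R]_(m, n)) : open U ->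
  U = \bigcup_(q in [set q | ratmx_box q `<=` U]) ratmx_box q.
Proof.
move=> oU; apply/seteqP; split=> [M UM|M [q qU /qU//]].
have /nbhs_ballP[e /= e0 eU] : nbhs M U by exact: open_nbhs_nbhs.
have [N Ne] : exists N : nat, N.+1%:R^-1 < e / 2.
  exists (Num.truncn (e / 2)^-1).
  by rewrite invf_plt ?posrE ?divr_gt0// truncnS_gt.
have N0 : 0 < N.+1%:R^-1 :> R by rewrite invr_gt0.
have H i j : exists q : rat, `|ratr q - M i j| < N.+1%:R^-1.
  have : M i j - N.+1%:R^-1 < M i j + N.+1%:R^-1.
    by rewrite ltrD2l gt0_cp.
  move=> /rat_in_itvoo[q]; rewrite in_itv/= => /andP[q1 q2]; exists q.
  by rewrite ltr_distl q1.
pose q i j := sval (cid (H i j)).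
have Hq i j : `|ratr (q i j) - M i j| < N.+1%:R^-1 by exact: (svalP (cid (H i j))).
exists (\matrix_(i, j) q i j, N) => /=; last by move=> i j /=; rewrite mxE.
move=> M' /= M'q; apply: eU; split=> // i j.
rewrite /ball /= (splitr e).
rewrite -(subrKA (ratr (q i j))) (le_lt_trans (ler_normD _ _))// ltrD//.
  by rewrite distrC (lt_trans (Hq i j)).
by have := M'q i j; rewrite mxE => /lt_trans; apply.
Qed.

Lemma measurable_fun_mx d (T : measurableType d) m n (f : T -> 'M[R]_(m, n)) :
  (forall i j, measurable_fun setT (fun t => f t i j)) -> measurable_fun setT f.
Proof.
move=> mf; apply: (@measurability _ _ _ _ _ _ (@open 'M[R]_(m, n))) => //.
move=> _ [U oU <-]; rewrite setTI (open_ratmx_box oU) preimage_bigcup bigcup_mkcond.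
apply: countable_bigcupT_measurable; first exact: countableP.
move=> q; case: ifPn => // _.
rewrite (_ : f @^-1` _ = \bigcap_(p in [set: 'I_m * 'I_n])
   [set t | `|ratr (q.1 p.1 p.2) - f t p.1 p.2| < q.2.+1%:R^-1]); last first.
  apply/seteqP; split => [t /= tq p _|t /= tq i j]; first exact: tq.
  exact: (tq (i, j)).
apply: fin_bigcap_measurable => // p _.
have mg : measurable_fun setT (fun t => `|ratr (q.1 p.1 p.2) - f t p.1 p.2|).
  by apply: measurableT_comp => //; exact: measurable_funB.
rewrite -[X in measurable X]setTI.
have := mg measurableT `]-oo, q.2.+1%:R^-1[%classic (measurable_itv _).
by congr measurable; apply/seteqP; split => t /=; rewrite in_itv.
Qed.

Lemma measurable_mx_entry m n i j :
  measurable_fun setT (fun M : 'M[R]_(m, n) => M i j).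
Proof.
apply: (@measurability _ _ _ _ _ _ _ (RGenOpens.measurableE R)).
move=> _ [_ [a [b ->] <-]]; rewrite setTI; apply: sub_sigma_algebra => /=.
apply: (@open_comp _ _ (fun M : 'M[R]_(m, n) => M i j)).
  by move=> M _; exact: coord_continuous.
exact: interval_open.
Qed.

End Borel_matrix.

Section Lebesgue.
Variable R : realType.

Definition snoc m (p : 'cV[R]_m * R) : 'cV[R]_m.+1 :=
  \col_i (if unlift ord_max i is Some j then p.1 j 0 else p.2).

Lemma measurable_snoc m : measurable_fun setT (@snoc m).
Proof.
apply: measurable_fun_mx => i j.
under eq_fun do rewrite mxE.
case: unlift => [k|]; last exact: measurable_snd.
apply: (measurableT_comp (measurable_mx_entry k 0)); exact: measurable_fst.
Qed.

Definition lebesgue_snoc m (mu : {measure set 'cV[R]_m -> \bar R}) :=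
  pushforward (mu \x @lebesgue_measure R)%E (@snoc m).

Section lebesgue_snoc_measure.
Context m (mu : {measure set 'cV[R]_m -> \bar R}).

Let nu : {measure set 'cV[R]_m.+1 -> \bar R} :=
  measure_function_pushforward__canonical__measure_function_Measure
    (mu \x @lebesgue_measure R)%E (@measurable_snoc m).

HB.instance Definition _ := @isMeasure.Build _ _ _ (lebesgue_snoc mu)
  (measure0 nu) (measure_ge0 nu) (@measure_semi_sigma_additive _ _ _ nu).

End lebesgue_snoc_measure.

Fixpoint lebesgue m : {measure set 'cV[R]_m -> \bar R} :=
  if m is m'.+1 then lebesgue_snoc (lebesgue m') else \d_(0 : 'cV[R]_0).

End Lebesgue.

Section Euclidean.
Variables (R : realType) (m : nat).

Definition enorm (x : 'cV[R]_m) : R := Num.sqrt (\sum_i x i 0 ^+ 2).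

Definition diam (W : set 'cV[R]_m) : R :=
  sup [set enorm (p.1 - p.2) | p in W `*` W].

Definition hausdorff_dist (K L : set 'cV[R]_m) : R :=
  Num.max (sup [set inf [set enorm (x - y) | y in L] | x in K])
          (sup [set inf [set enorm (x - y) | x in K] | y in L]).

Record ncompact := NCompact {
  ncompact_set :> set 'cV[R]_m;
  ncompact_neq0 : ncompact_set !=set0;
  ncompactP : compact ncompact_set }.

HB.instance Definition _ := gen_eqMixin ncompact.
HB.instance Definition _ := gen_choiceMixin ncompact.
HB.instance Definition _ := isPointed.Build ncompact
  (@NCompact [set 0] (ex_intro _ 0 erefl) (@compact_set1 'cV[R]_m 0)).

Definition hausdorff_open : set (set ncompact) :=
  [set U : set ncompact | forall K : ncompact, U K -> exists2 e : R, 0 < e &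
     forall L : ncompact, hausdorff_dist K L < e -> U L].

HB.instance Definition _ :=
  @isMeasurable.Build (sigma_display hausdorff_open) ncompact
    <<s hausdorff_open >> (@sigma_algebra0 _ setT hausdorff_open)
    (@sigma_algebraC _ hausdorff_open)
    (@sigma_algebra_bigcup _ setT hausdorff_open).

End Euclidean.

Section Rotations.
Variables (R : realType) (d : nat) (k : 'I_d).

(* 0-based: e_i here is e_{i+1} in the usual numbering. *)
Definition std_basis (i : 'I_d) : 'cV[R]_d := delta_mx i 0.

Definition E_ : {vspace 'cV[R]_d} :=
  <<[seq std_basis i | i : 'I_d <- enum 'I_d & (d - k <= i)%N]>>%VS.

Definition embed (x : 'cV[R]_(d - k)) : 'cV[R]_d :=
  \sum_i x i 0 *: std_basis (widen_ord (leq_subr k d) i).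

Definition SO : set 'M[R]_d := [set M | M *m M^T = 1%:M /\ \det M = 1].

Definition grassmannian : set {vspace 'cV[R]_d} := [set L | \dim L = k].

Definition rotations_to (L : {vspace 'cV[R]_d}) : set 'M[R]_d :=
  [set M | SO M /\ L = (linfun (mulmx M : 'cV[R]_d -> 'cV[R]_d) @: E_)%VS].

Definition row_major (M : 'M[R]_d) : seqlexi R :=
  [seq M i j | i <- enum 'I_d, j <- enum 'I_d].

Definition is_lex_min (A : set 'M[R]_d) (M : 'M[R]_d) : Prop :=
  A M /\ forall N, A N -> (row_major M <= row_major N)%O.

(* The default value of [xget] is irrelevant here: the sets [rotations_to L]
   with L in the Grassmannian are non-empty and compact, hence have a
   lexicographic minimum, which is unique. *)
Definition lex_min (A : set 'M[R]_d) : 'M[R]_d := xget 1%:M (is_lex_min A).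

Definition SO_rep : set 'M[R]_d :=
  [set lex_min (rotations_to L) | L in grassmannian].

Record SOdk := MkSOdk { SOdk_mx :> 'M[R]_d; SOdkP : SO_rep SOdk_mx }.

Lemma grassmannian_neq0 : grassmannian !=set0.
Proof.
pose X := vbasis (fullv : {vspace 'cV[R]_d}).
exists <<take k X>>%VS => /=.
have dX : size X = d by rewrite size_tuple dimvf /dim /= muln1.
have : free (take k X).
  by apply: (@catl_free _ _ (drop k X)); rewrite cat_take_drop (basis_free (vbasisP _)).
by move=> /eqP; rewrite size_take dX ltn_ord.
Qed.

Lemma SO_rep_neq0 : SO_rep !=set0.
Proof. by have [L GL] := grassmannian_neq0; exists (lex_min (rotations_to L)); exists L. Qed.

HB.instance Definition _ := gen_eqMixin SOdk.
HB.instance Definition _ := gen_choiceMixin SOdk.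
HB.instance Definition _ :=
  isPointed.Build SOdk (MkSOdk (svalP (cid SO_rep_neq0))).

Definition SOdk_open : set (set SOdk) := preimage_set_system setT SOdk_mx open.

HB.instance Definition _ :=
  @isMeasurable.Build (sigma_display SOdk_open) SOdk
    <<s SOdk_open >> (@sigma_algebra0 _ setT SOdk_open)
    (@sigma_algebraC _ SOdk_open) (@sigma_algebra_bigcup _ setT SOdk_open).

(* Z(x, theta, K) = theta ((x + K) x E_k), where (x + K) x E_k is the set of the
   sums y + v with y in x + K, seen in R^d, and v in E_k. *)
Definition cylinder (p : 'cV[R]_(d - k) * (SOdk * ncompact R (d - k))) :
    set 'cV[R]_d :=
  [set p.2.1 *m (embed (p.1 + z) + v) | z in p.2.2 & v in [set` E_]].

End Rotations.

Arguments SOdk R {d} k.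

Section PointProcess.
Local Open Scope ereal_scope.
Context {R : realType} {d d' : measure_display}.
Context {Omega : measurableType d} {X : measurableType d'}.

(* A counting measure is a countable sum of finite measures with integer
   values. *)
Definition counting_measure (mu : {measure set X -> \bar R}) : Prop :=
  exists mu_ : {measure set X -> \bar R}^nat,
    (forall i B, measurable B -> exists n : nat, mu_ i B = n%:R%:E) /\
    (forall B, measurable B -> mu B = mseries mu_ 0 B).

Definition atoms (mu : {measure set X -> \bar R}) : set X :=
  [set p | 0 < mu [set p]].

(* The pmf is spelled out because [poisson_pmf] is not a pmf at rate 0. *)
Definition poisson_distributed (P : probability Omega R) (N : Omega -> \bar R)
    (mean : \bar R) : Prop :=
  match mean with
  | r%:E => forall n : nat,
      P [set w | N w = n%:R%:E] = (r ^+ n / n`!%:R * expR (- r))%:E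
  | _ => P [set w | N w = +oo] = 1
  end.

Record poisson_process (P : probability Omega R) (nu : set X -> \bar R)
    (eta : Omega -> {measure set X -> \bar R}) : Prop := PoissonProcess {
  poisson_process_measurable : forall B, measurable B ->
    measurable_fun setT (fun w => eta w B);
  poisson_process_counting : forall w, counting_measure (eta w);
  poisson_process_poisson : forall B, measurable B ->
    poisson_distributed P (fun w => eta w B) (nu B);
  poisson_process_independent : forall (n : nat) (B : 'I_n -> set X),
    (forall i, measurable (B i)) -> trivIset setT B ->
    forall C : 'I_n -> set (\bar R), (forall i, measurable (C i)) ->
    P (\bigcap_i [set w | C i (eta w (B i))]) =
      \prod_(i < n) P [set w | C i (eta w (B i))] }.

End PointProcess.

Section CylinderModel.
Local Open Scope ereal_scope.
Context {R : realType} {n : nat} {k : 'I_n}.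
Implicit Types Q : probability (SOdk R k * ncompact R (n - k))%type R.

Definition cylinder_intensity (gamma : R) Q
    (B : set ('cV[R]_(n - k) * (SOdk R k * ncompact R (n - k)))) : \bar R :=
  gamma%:E * (lebesgue R (n - k) \x Q) B.

Definition typical_cylinder_base d (T : measurableType d)
    (P : probability T R) Q (Xi : T -> ncompact R (n - k)) : Prop :=
  measurable_fun setT Xi /\
  forall B, measurable B -> P (Xi @^-1` B) = Q (snd @^-1` B).

Definition cylinder_union d (T : measurableType d)
    (eta : T -> {measure set ('cV[R]_(n - k) *
                             (SOdk R k * ncompact R (n - k))) -> \bar R})
    (w : T) : set 'cV[R]_n :=
  \bigcup_(p in atoms (eta w)) cylinder p.

End CylinderModel.

(* Main.v *)
Require Import Defs.
From HB Require Import structures.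
From mathcomp Require Import all_boot all_order all_algebra.
From mathcomp Require Import all_classical all_reals all_analysis.
From mathcomp Require Import measurable_realfun ring lra.
Import Order.TTheory GRing.Theory Num.Theory.
Import numFieldNormedType.Exports.
Set Implicit Arguments.
Unset Strict Implicit.
Unset Printing Implicit Defensive.
Local Open Scope classical_set_scope.
Local Open Scope ring_scope.

(** The covered volume is monotone and subadditive in the set of cylinders, and
both tails come from one exponential-moment computation for finitely many
independent sets.

Finite model. Let sets [D_1], ..., [D_N] be switched on independently with
probabilities [q_i], let [f] be the volume of the union of those that are on, and
reveal the sets one by one. If [U] is the region still uncovered, let [M(U)] be
the mean of what the remaining sets will cover of it; [M] is additive in [U].
Putting [D_i] in front of the list raises the mean by [q_i v], [v = u - g], where
[u] is the volume of [D_i] in [U] and [g] is the mean of what the later sets cover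
of [D_i] in [U]. With [0 <= v <= vol D_i <= b], induction on [N] gives
[E e^(l f) <= e^((l + 2 l^2 b) E f)] for [l b <= 1/2] ([coverage_upper_laplace])
and [E e^(- l f) <= e^(- l E f + l^2 sum_i q_i (vol D_i)^2)]
([coverage_lower_laplace]). As [E f] is at most the volume of the window, the
intensity does not enter the upper bound.

Poisson process. In the measure algebra of the window, which is separable
([separable_measure_algebra]), the cylinders cut by the window are sorted into
countably many cells of radius [e], and each cell is represented by one set. The
events that the cells contain an atom are independent
([poisson_prefix_independent]), so that the finite model applies to the first [N]
cells inside a region of finite intensity. Bounded convergence carries the bounds
through the limits [N -> oo], [e -> 0], and exhaustion of the space by such
regions ([poisson_coverage_upper], [poisson_coverage_lower]). The same sorting
shows that the covered volume is measurable ([measurable_covered]): that it exceeds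
a given level is decided by which of countably many sets of cylinders are hit.

Geometry. In a frame rotated by [theta] a cylinder is the product of its base with
[k] coordinate axes, along which the window extends over at most its diameter;
hence a cylinder covers at most [b = A diam(W)^k] of the window
([leb_cylinderI_le]). Integrating over the position first, the cylinders with a
given mark cover [vol(K) vol(W)] in total ([mean_window_volume]), so that
[sum_i q_i (vol D_i)^2] is at most about [b gamma A vol(W)]. Both facts need
Lebesgue measure to be invariant under reflections and rotations, which follows
from translation invariance by Fubini's theorem ([leb_orthogonal_swap]).

Tails. Markov's inequality with [l = t / (4 b vol(W))] for the upper tail, where
only [t <= vol(W)] matters, and with [l = t / (2 v)], [v = gamma A b vol(W)], for
the lower one, gives exponents [t^2 / (8 b vol(W))] and [t^2 / (4 v)]; the constant
[c = ln 2 / (8 kappa)] is at most [1/8] since [kappa >= 1]. *)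

(** * Random coverage by finitely many independent sets *)

Section exponential_bounds.
Variable R : realType.
Implicit Types x q : R.

Lemma expR_le_quadratic x : 0 <= x <= 1 / 2 -> expR x <= 1 + x + 2 * x ^+ 2.
Proof.
move=> /andP[x0 x1]; have x1' : 0 < 1 - x by lra.
have : expR x <= (1 - x)^-1.
  by rewrite -[x in leLHS]opprK expRN lef_pV2 ?posrE ?expR_gt0// expR_ge1Dx.
move=> /le_trans; apply; rewrite -div1r ler_pdivrMr//.
have := mulr_ge0 (sqr_ge0 x) (_ : 0 <= 1 - 2 * x); rewrite !expr2; nra.
Qed.

Lemma expRN_le_quadratic x : 0 <= x -> expR (- x) <= 1 - x + x ^+ 2.
Proof.
move=> x0; have x1 : 0 < 1 + x by lra.
have : expR (- x) <= (1 + x)^-1.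
  by rewrite expRN lef_pV2 ?posrE ?expR_gt0// expR_ge1Dx.
move=> /le_trans; apply; rewrite -div1r ler_pdivrMr//.
have := exprn_ge0 3 x0; rewrite !exprS expr0; nra.
Qed.

Lemma expR_mixture q x : 1 - q + q * expR x <= expR (q * (expR x - 1)).
Proof. by apply: le_trans (expR_ge1Dx _); lra. Qed.

End exponential_bounds.

Section random_coverage.
Context {R : realType} {dY : measure_display} {Y : measurableType dY}.
Variable mu : {finite_measure set Y -> \bar R}.

Definition vol (A : set Y) : R := fine (mu A).

Lemma volK A : measurable A -> (vol A)%:E = mu A.
Proof. by move=> mA; rewrite /vol fineK// fin_num_measure. Qed.

Lemma vol_ge0 A : 0 <= vol A. Proof. exact: fine_ge0. Qed.

Lemma vol0 : vol set0 = 0. Proof. by rewrite /vol measure0. Qed.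

Lemma volID A B : measurable A -> measurable B ->
  vol A = vol (A `&` B) + vol (A `\` B).
Proof.
move=> mA mB; apply: EFin_inj; rewrite EFinD !volK//.
- by rewrite addeC -measureDI.
- exact: measurableD.
- exact: measurableI.
Qed.

Lemma le_vol A B : measurable A -> measurable B -> A `<=` B -> vol A <= vol B.
Proof.
by move=> mA mB AB; rewrite -lee_fin !volK// le_measure ?inE.
Qed.

Lemma vol_setU_le A B : measurable A -> measurable B ->
  vol (A `|` B) <= vol A + vol B.
Proof.
move=> mA mB; rewrite (volID (measurableU _ _ mA mB) mA) setUK lerD2l.
apply: le_vol => //; first by apply: measurableD => //; exact: measurableU.
by rewrite setDUl setDv set0U => x [].
Qed.

Variables (q : nat -> R) (D : nat -> set Y).
Hypothesis q01 : forall i, 0 <= q i <= 1.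
Hypothesis mD : forall i, measurable (D i).

(** In the three recursions below the sets [D i], ..., [D (i + r - 1)] are
switched on independently of each other with probabilities [q i], ...,
[q (i + r - 1)], [U] is the region not covered so far, and [a] is the volume
covered so far. *)
Fixpoint coverage_law (phi : R -> R) (r i : nat) (U : set Y) (a : R) : R :=
  if r is r'.+1 then
    (1 - q i) * coverage_law phi r' i.+1 U a
    + q i * coverage_law phi r' i.+1 (U `\` D i) (a + vol (U `&` D i))
  else phi a.

Fixpoint coverage_mean (r i : nat) (U : set Y) : R :=
  if r is r'.+1 then
    (1 - q i) * coverage_mean r' i.+1 U
    + q i * (vol (U `&` D i) + coverage_mean r' i.+1 (U `\` D i))
  else 0.

Fixpoint coverage_energy (r i : nat) : R :=
  if r is r'.+1 then q i * vol (D i) ^+ 2 + coverage_energy r' i.+1 else 0.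

Lemma coverage_lawid r i U a : coverage_law id r i U a = a + coverage_mean r i U.
Proof.
elim: r i U a => [|r IH] i U a /=; first by rewrite addr0.
by rewrite !IH; ring.
Qed.

Lemma coverage_mean_setID r i U V : measurable U -> measurable V ->
  coverage_mean r i U
  = coverage_mean r i (U `&` V) + coverage_mean r i (U `\` V).
Proof.
elim: r i U => [|r IH] i U mU mV /=; first by rewrite addr0.
have mUD : measurable (U `&` D i) by exact: measurableI.
have mU'D : measurable (U `\` D i) by exact: measurableD.
rewrite (IH _ U)// (IH _ (U `\` D i))// (volID mUD mV).
rewrite [U `&` V `&` _]setIAC [(U `\` D i) `&` V]setIDAC setIDA.
have -> : U `&` D i `\` V = (U `\` V) `&` D i by rewrite -setIDA -setIDAC.
by rewrite setDDl [D i `|` V]setUC -setDDl; ring.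
Qed.

Lemma coverage_mean_itv r i U : measurable U ->
  0 <= coverage_mean r i U <= vol U.
Proof.
elim: r i U => [|r IH] i U mU /=; first by rewrite lexx vol_ge0.
have mU'D : measurable (U `\` D i) by exact: measurableD.
have /andP[q0 q1] := q01 i.
have /andP[m0 m1] := IH i.+1 _ mU; have /andP[m0' m1'] := IH i.+1 _ mU'D.
have := volID mU (mD i); have := vol_ge0 (U `&` D i).
move=> u0 UE; apply/andP; split.
  by rewrite addr_ge0// mulr_ge0 ?subr_ge0// addr_ge0.
have -> : vol U = (1 - q i) * vol U + q i * vol U by ring.
by rewrite lerD// ler_wpM2l ?subr_ge0// [leRHS]UE lerD2l.
Qed.

(** What the next set adds is discounted by the part that the later sets would
cover anyway; only the difference [u - g] enters the recursion for the mean. *)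
Lemma coverage_meanS r i U : measurable U ->
  let u := vol (U `&` D i) in let g := coverage_mean r i.+1 (U `&` D i) in
  [/\ 0 <= u - g, u - g <= vol (D i),
      coverage_mean r i.+1 (U `\` D i) = coverage_mean r i.+1 U - g &
      coverage_mean r.+1 i U = coverage_mean r i.+1 U + q i * (u - g)].
Proof.
move=> mU u g; have mUD : measurable (U `&` D i) by exact: measurableI.
have /andP[g0 gu] := coverage_mean_itv r i.+1 mUD.
have uD : u <= vol (D i) by apply: le_vol => // x [].
have ID := coverage_mean_setID r i.+1 mU (mD i).
have E : coverage_mean r i.+1 (U `\` D i) = coverage_mean r i.+1 U - g.
  by rewrite ID /g; ring.
split => //; rewrite ?E -/u.
- by rewrite subr_ge0.
- by rewrite (le_trans _ uD)// gerDl oppr_le0.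
- by rewrite /= E -/u -/g; ring.
Qed.

(** By [expR_mixture] the induction step reduces to
[e^(l u - k g) - 1 <= k (u - g)] with [k = l + 2 l^2 b], which holds because
[l <= k] and [l (u - g) <= 1/2]. *)
Lemma coverage_upper_laplace (l b : R) r i U a : 0 <= l -> measurable U ->
  (forall j, (i <= j < i + r)%N -> vol (D j) <= b) -> l * b <= 1 / 2 ->
  coverage_law (fun x => expR (l * x)) r i U a
  <= expR (l * a + (l + 2 * l ^+ 2 * b) * coverage_mean r i U).
Proof.
move=> l0; elim: r i U a => [|r IH] i U a mU Db lb; first by rewrite /= mulr0 addr0.
have /andP[q0 q1] := q01 i.
have Di : vol (D i) <= b by apply: Db; rewrite leqnn/= addnS ltnS leq_addr.
have Db' j : (i.+1 <= j < i.+1 + r)%N -> vol (D j) <= b.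
  by move=> /andP[ij jr]; apply: Db; rewrite (ltnW ij)/= addnS -addSn.
have b0 : 0 <= b by exact: le_trans (vol_ge0 (D i)) Di.
have mU' : measurable (U `\` D i) by exact: measurableD.
have [v0 vD mE ->] := coverage_meanS r i mU.
rewrite [coverage_law _ _ _ _ _]/=.
have h1 := IH i.+1 U a mU Db' lb.
have h2 := IH i.+1 _ (a + vol (U `&` D i)) mU' Db' lb.
rewrite mE in h2.
set u := vol (U `&` D i) in v0 vD h2 *.
set g := coverage_mean r i.+1 (U `&` D i) in v0 vD h2 *.
set M := coverage_mean r i.+1 U in h1 h2 *.
set k := l + _.
have k0 : l <= k by rewrite lerDl !mulr_ge0// sqr_ge0.
apply: (@le_trans _ _ (expR (l * a + k * M) * (1 - q i + q i * expR (l * u - k * g)))).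
  rewrite mulrDr [expR _ * (1 - q i)]mulrC [expR _ * (q i * _)]mulrCA lerD//.
    by rewrite ler_wpM2l// subr_ge0.
  rewrite ler_wpM2l// (le_trans h2)// -expRD ler_expR.
  by rewrite le_eqVlt; apply/orP; left; apply/eqP; rewrite /k; ring.
have -> : l * a + k * (M + q i * (u - g))
  = (l * a + k * M) + q i * (k * (u - g)) by ring.
rewrite [leRHS]expRD ler_wpM2l ?expR_ge0//.
apply: le_trans (expR_mixture _ _) _; rewrite ler_expR ler_wpM2l//.
have g0 : 0 <= g.
  by have /andP[] := coverage_mean_itv r i.+1 (measurableI _ _ mU (mD i)).
have h3 : expR (l * u - k * g) <= expR (l * (u - g)).
  by rewrite ler_expR mulrBr lerD2l lerN2 ler_wpM2r.
have lv : 0 <= l * (u - g) <= 1 / 2.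
  rewrite mulr_ge0//= (le_trans _ lb)// ler_wpM2l//; exact: le_trans vD Di.
have := expR_le_quadratic lv.
have : l ^+ 2 * (u - g) ^+ 2 <= l ^+ 2 * b * (u - g).
  rewrite -mulrA ler_wpM2l ?sqr_ge0// expr2 ler_wpM2r//; exact: le_trans vD Di.
rewrite exprMn /k; move: (expR _) (expR _) h3 => x y; nra.
Qed.

(** Here the induction step is [e^(- l v) - 1 <= - l v + l^2 v^2] with
[v = u - g <= vol (D i)], which holds for every [l >= 0]. *)
Lemma coverage_lower_laplace (l : R) r i U a : 0 <= l -> measurable U ->
  coverage_law (fun x => expR (- (l * x))) r i U a
  <= expR (- (l * a) - l * coverage_mean r i U + l ^+ 2 * coverage_energy r i).
Proof.
move=> l0; elim: r i U a => [|r IH] i U a mU.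
  by rewrite /= !mulr0 subr0 addr0.
have /andP[q0 q1] := q01 i.
have mU' : measurable (U `\` D i) by exact: measurableD.
have [v0 vD mE ->] := coverage_meanS r i mU.
rewrite [coverage_law _ _ _ _ _]/= [coverage_energy _ _]/=.
have h1 := IH i.+1 U a mU.
have h2 := IH i.+1 _ (a + vol (U `&` D i)) mU'.
rewrite mE in h2.
set u := vol (U `&` D i) in v0 vD h2 *.
set g := coverage_mean r i.+1 (U `&` D i) in v0 vD h2 *.
set M := coverage_mean r i.+1 U in h1 h2 *.
set S := coverage_energy r i.+1 in h1 h2 *.
set e0 := - (l * a) - l * M + l ^+ 2 * S in h1.
apply: (@le_trans _ _ (expR e0 * (1 - q i + q i * expR (- (l * (u - g)))))).
  rewrite mulrDr [expR _ * (1 - q i)]mulrC [expR _ * (q i * _)]mulrCA lerD//.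
    by rewrite ler_wpM2l// subr_ge0.
  rewrite ler_wpM2l// (le_trans h2)// -expRD ler_expR.
  by rewrite le_eqVlt; apply/orP; left; apply/eqP; rewrite /e0; ring.
have -> : - (l * a) - l * (M + q i * (u - g)) + l ^+ 2 * (q i * vol (D i) ^+ 2 + S)
  = e0 + q i * (l ^+ 2 * vol (D i) ^+ 2 - l * (u - g)) by rewrite /e0; ring.
rewrite [leRHS]expRD ler_wpM2l ?expR_ge0//.
apply: le_trans (expR_mixture _ _) _; rewrite ler_expR ler_wpM2l//.
have := expRN_le_quadratic (mulr_ge0 l0 v0).
have : l ^+ 2 * (u - g) ^+ 2 <= l ^+ 2 * vol (D i) ^+ 2.
  by rewrite ler_wpM2l ?sqr_ge0// lerXn2r ?nnegrE// vol_ge0.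
by rewrite exprMn; move: (expR _) => x; nra.
Qed.

End random_coverage.

Section independent_coverage.
Context {R : realType} {dY : measure_display} {Y : measurableType dY}.
Variable mu : {finite_measure set Y -> \bar R}.
Context {dT : measure_display} {T : measurableType dT}.
Variables (P : probability T R) (A : nat -> set T) (D : nat -> set Y).
Hypothesis mA : forall i, measurable (A i).
Hypothesis mD : forall i, measurable (D i).

Local Notation q := (fun i => fine (P (A i))).

Let q01 i : 0 <= q i <= 1.
Proof.
by rewrite fine_ge0//= -lee_fin fineK ?fin_num_measure// probability_le1.
Qed.

(** Volume of [U] covered by those of [D i], ..., [D (i + r - 1)] that are
switched on at [w], accumulated in the order in which [coverage_law] does. *)
Fixpoint coverage (r i : nat) (U : set Y) (w : T) : R :=
  if r is r'.+1 then
    if w \in A i then vol mu (U `&` D i) + coverage r' i.+1 (U `\` D i) w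
    else coverage r' i.+1 U w
  else 0.

Lemma coverageE r i U w : measurable U -> coverage r i U w =
  vol mu (U `&` \bigcup_(j in [set j | (i <= j < i + r)%N /\ A j w]) D j).
Proof.
elim: r i U => [|r IH] i U mU /=.
  rewrite (_ : [set _ | _] = set0) ?bigcup_set0 ?setI0 ?vol0//.
  apply/seteqP; split => // j /= [/andP[ij ji] _].
  by move: (leq_ltn_trans ij ji); rewrite addn0 ltnn.
have step : [set j | (i <= j < i + r.+1)%N /\ A j w] =
    [set j | (i.+1 <= j < i.+1 + r)%N /\ A j w] `|` [set j | j = i /\ A j w].
  apply/seteqP; split => j /=; rewrite addnS addSn.
    move=> [/andP[]]; rewrite leq_eqVlt => /orP[/eqP <-|ij jr Aj]; last first.
      by left; rewrite ij jr.
    by move=> _ Aj; right.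
  move=> [[/andP[ij jr] Aj]|[-> Aj]]; first by rewrite (ltnW ij) jr.
  by rewrite leqnn ltnS leq_addr.
have mcup (S : set nat) : measurable (\bigcup_(j in S) D j).
  by apply: bigcup_measurable => j _; exact: mD.
case: ifPn => [/set_mem Aw|/negP Aw].
  rewrite IH; last exact: measurableD.
  rewrite step bigcup_setU (_ : [set j | j = i /\ _] = [set i]); last first.
    by apply/seteqP; split => [j []//|j /= ->].
  rewrite bigcup_set1; set B := \bigcup_(_ in _) _.
  have mB : measurable B by exact: mcup.
  rewrite (@volID _ _ _ mu (U `&` (B `|` D i)) (D i))//; last first.
    by apply: measurableI => //; exact: measurableU.
  congr (vol mu _ + vol mu _).
    by rewrite -setIA [B `|` _]setUC setUK.
  rewrite setIDAC; apply/seteqP; split => [x [Ux [Bx nD]]|x [[Ux [Bx|Dx]] nD]]//.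
    by split => //; split => //; left.
rewrite IH// step (_ : [set j | j = i /\ _] = set0) ?setU0//.
by apply/seteqP; split => // j /= [-> Ai]; apply: Aw; exact: mem_set.
Qed.

Lemma measurable_coverage r i U : measurable_fun setT (coverage r i U).
Proof.
elim: r i U => [|r IH] i U /=; first exact: measurable_cst.
apply: measurable_fun_if => //.
- apply: (@measurable_fun_bool _ _ _ _ true) => /=.
  rewrite setTI (_ : _ @^-1` _ = A i)//.
  by apply/seteqP; split => x /=; [exact: set_mem|exact: mem_set].
- by apply: measurable_funD => //; apply: measurable_funS (IH _ _).
- by apply: measurable_funS (IH _ _).
Qed.

Lemma coverage_ge0 r i U w : 0 <= coverage r i U w.
Proof.
by elim: r i U => //= r IH i U; case: ifP => // _; rewrite addr_ge0// vol_ge0.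
Qed.

(** The events that fix which of the first [i] sets are on: integrating over each
of them follows the recursion of [coverage_law] set by set. *)
Inductive prefix_event : nat -> set T -> Prop :=
| prefix_event0 : prefix_event 0 setT
| prefix_event_in i E : prefix_event i E -> prefix_event i.+1 (E `&` A i)
| prefix_event_notin i E : prefix_event i E -> prefix_event i.+1 (E `\` A i).

Lemma measurable_prefix_event i E : prefix_event i E -> measurable E.
Proof.
elim=> // {}i {}E _ mE; first exact: measurableI.
by apply: measurableD.
Qed.

Variable N : nat.
Hypothesis indepA : forall i E, (i < N)%N -> prefix_event i E ->
  P (E `&` A i) = (P E * P (A i))%E.

Lemma integral_coverage (phi : R -> R) r i U (a : R) E :
  measurable_fun setT phi -> (forall x, 0 <= x -> 0 <= phi x) -> 0 <= a ->
  (i + r <= N)%N -> prefix_event i E ->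
  (\int[P]_(w in E) (phi (a + coverage r i U w))%:E =
   P E * (coverage_law mu q D phi r i U a)%:E)%E.
Proof.
move=> mphi phi0; elim: r i U a E => [|r IH] i U a E a0 iN pE.
  rewrite /= (@integral_cst _ _ _ P E (measurable_prefix_event pE)).
  by rewrite addr0 muleC.
have mE := measurable_prefix_event pE.
have iN' : (i < N)%N by rewrite (leq_trans _ iN)// addnS ltnS leq_addr.
have Pf B : measurable B -> P B \is a fin_num by move=> ?; exact: fin_num_measure.
have PI : P (E `&` A i) = (P E * (q i)%:E)%E.
  by rewrite indepA// fineK// Pf.
have PD : P (E `\` A i) = (P E * (1 - q i)%:E)%E.
  have -> : P (E `\` A i) = (P E - P (E `&` A i))%E.
    by rewrite measureD// -?ge0_fin_numE// Pf.
  by rewrite PI EFinB muleBr ?mule1// Pf.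
have mf U' a' r' i' : measurable_fun setT
    (fun w => (phi (a' + coverage r' i' U' w))%:E).
  apply/measurable_EFinP; apply: measurableT_comp => //.
  by apply: measurable_funD => //; exact: measurable_coverage.
rewrite -[X in integral _ X _](setUIDK E (A i)).
rewrite ge0_integral_setU//=; last 5 first.
- exact: measurableI.
- exact: measurableD.
- exact: measurable_funS (mf _ _ r.+1 _).
- by move=> w _; rewrite lee_fin phi0// addr_ge0// (coverage_ge0 r.+1).
- by apply/disj_setPS => w [[_ Aw] [_]].
under eq_integral.
  move=> w /set_mem[_ /mem_set ->]; rewrite addrA; over.
rewrite [X in (_ + X)%E](_ : _ =
    \int[P]_(w in E `\` A i) (phi (a + coverage r i.+1 U w))%:E)%E; last first.
  apply: eq_integral => w /set_mem[_ Aw].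
  by rewrite ifF//; apply/negP => /set_mem.
rewrite (IH _ _ _ (E `&` A i)) ?addSnnS//; last 2 first.
- by rewrite addr_ge0// vol_ge0.
- exact: prefix_event_in.
rewrite (IH _ _ _ (E `\` A i)) ?addSnnS//; last exact: prefix_event_notin.
rewrite PI PD -!muleA -!EFinM -muleDr ?Pf// ?fin_num_adde_defl//.
by rewrite -EFinD; congr (_ * _%:E)%E; exact: addrC.
Qed.

Let w0 := vol mu setT.

Lemma integral_coverage_mean :
  (\int[P]_w (coverage N 0 setT w)%:E = (coverage_mean mu q D N 0 setT)%:E)%E.
Proof.
(* [integral_coverage] is about nonnegative functions, and on volumes the
   identity agrees with its positive part. *)
have := @integral_coverage (fun x => Num.max x 0) N 0 setT 0 setT.
rewrite lexx add0n leqnn => /(_ _ _ isT isT prefix_event0).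
rewrite probability_setT mul1e.
have maxid r i U a : 0 <= a ->
    coverage_law mu q D (fun x => Num.max x 0) r i U a = coverage_law mu q D id r i U a.
  elim: r i U a => [|r IH] i U a a0 /=; first by rewrite max_l.
  by rewrite !IH// addr_ge0// vol_ge0.
rewrite maxid// coverage_lawid add0r => <-.
- by apply: eq_integral => w _; rewrite add0r max_l// coverage_ge0.
- by apply: measurable_maxr => //; exact: measurable_id.
- by move=> x x0; rewrite le_max lexx orbT.
Qed.

Lemma coverage_mgf_upper (l b : R) : 0 <= l -> l * b <= 1 / 2 ->
  (forall j, (j < N)%N -> vol mu (D j) <= b) -> 0 <= b ->
  (\int[P]_w (expR (l * coverage N 0 setT w))%:E <=
   (expR (l * fine (\int[P]_w (coverage N 0 setT w)%:E) + 2 * l ^+ 2 * b * w0))%:E)%E.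
Proof.
move=> l0 lb Db b0; rewrite integral_coverage_mean/=.
have := @integral_coverage (fun x => expR (l * x)) N 0 setT 0 setT.
rewrite lexx add0n leqnn => /(_ _ _ isT isT prefix_event0).
rewrite probability_setT mul1e.
under eq_integral do rewrite add0r.
move=> ->; last 2 first.
- by apply: measurableT_comp => //; exact: measurable_funM.
- by move=> x _; exact: expR_ge0.
rewrite lee_fin.
have /andP[M0 M1] := @coverage_mean_itv _ _ _ mu _ _ q01 mD N 0 setT measurableT.
apply: le_trans (@coverage_upper_laplace _ _ _ mu _ _ q01 mD l b N 0 setT 0 l0 _ _ lb) _ => //.
rewrite ler_expR mulr0 add0r mulrDl lerD2l ler_wpM2l//.
by rewrite !mulr_ge0// sqr_ge0.
Qed.

Lemma coverage_mgf_lower (l : R) : 0 <= l ->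
  (\int[P]_w (expR (- (l * coverage N 0 setT w)))%:E <=
   (expR (- (l * fine (\int[P]_w (coverage N 0 setT w)%:E))
          + l ^+ 2 * \sum_(j < N) q j * vol mu (D j) ^+ 2))%:E)%E.
Proof.
move=> l0; rewrite integral_coverage_mean/=.
have := @integral_coverage (fun x => expR (- (l * x))) N 0 setT 0 setT.
rewrite lexx add0n leqnn => /(_ _ _ isT isT prefix_event0).
rewrite probability_setT mul1e.
under eq_integral do rewrite add0r.
move=> ->; last 2 first.
- apply: measurableT_comp => //; apply: measurable_funN.
  exact: measurable_funM.
- by move=> x _; exact: expR_ge0.
rewrite lee_fin.
apply: le_trans (@coverage_lower_laplace _ _ _ mu _ _ q01 mD l N 0 setT 0 l0 _) _ => //.
have -> : coverage_energy mu q D N 0 = \sum_(j < N) q j * vol mu (D j) ^+ 2.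
  have energyE r i : coverage_energy mu q D r i
      = \sum_(i <= j < i + r) q j * vol mu (D j) ^+ 2.
    elim: r i => [|r IH] i /=; first by rewrite addn0 big_geq.
    by rewrite IH [RHS]big_ltn ?addSnnS// addnS ltnS leq_addr.
  by rewrite energyE add0n big_mkord.
by rewrite ler_expR mulr0 oppr0 sub0r.
Qed.

End independent_coverage.

(** * Atoms of counting measures *)

Section atoms_of_counting_measures.
Context {R : realType} {dX : measure_display} {X : measurableType dX}.
Variable V : nat -> set X.
Hypothesis mV : forall n, measurable (V n).
Hypothesis V_sep : forall x y, (forall n, V n x <-> V n y) -> x = y.

Lemma measurable_set1_separated (p : X) : measurable [set p].
Proof.
rewrite (_ : [set p] = \bigcap_n (if p \in V n then V n else ~` V n)).
  apply: bigcapT_measurable => n; case: ifP => _ //; exact: measurableC.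
apply/seteqP; split => [_ -> n _|x px].
  by case: ifPn => [/set_mem//|/negP pV pV']; apply: pV; exact: mem_set.
apply: V_sep => n; have := px n I; case: ifPn => [/set_mem pV xV//|/negP pV xV].
by split => // pV'; exfalso; apply: pV; exact: mem_set.
Qed.

(** Halve [B] along [V 0], [V 1], ..., always keeping a half of positive, hence
at least unit, mass. The intersection has unit mass and at most one point. *)
Lemma integer_valued_measure_atom (m : {measure set X -> \bar R}) B :
  (forall A, measurable A -> exists n : nat, m A = n%:R%:E) ->
  measurable B -> (0 < m B)%E -> exists2 p, B p & (0 < m [set p])%E.
Proof.
move=> mint mB B0.
have m1 A : measurable A -> (0 < m A)%E -> (1%:E <= m A)%E.
  by move=> /mint[[|n] ->]; rewrite ?lte_fin ?ltxx// lee_fin ler1n.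
pose S := fix S n := if n is k.+1 then
  if `[< (0 < m (S k `&` V k))%E >] then S k `&` V k else S k `\` V k else B.
have SP n : measurable (S n) /\ (0 < m (S n))%E.
  elim: n => [|n [mS S0]]//=; case: asboolP => SV.
    by split => //; exact: measurableI.
  split; first exact: measurableD.
  rewrite -(setUIDK (S n) (V n)) measureU//= in S0.
  - move: S0; have -> : m (S n `&` V n) = 0%E; last by rewrite add0e.
    by apply/eqP; rewrite eq_le measure_ge0 andbT leNgt; apply/negP.
  - exact: measurableI.
  - exact: measurableD.
  - by rewrite setDE setIACA setICr setI0.
have nS i j : (i <= j)%N -> S j `<=` S i.
  elim: j => [|j IH]; first by rewrite leqn0 => /eqP ->.
  rewrite leq_eqVlt => /orP[/eqP ->//|/IH Sij]; apply: subset_trans Sij => /=.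
  by case: ifP => _; [exact: subIsetl|exact: subDsetl].
have mS : measurable (\bigcap_n S n).
  by apply: bigcapT_measurable => n; have [] := SP n.
have cS : m (S n) @[n --> \oo] --> m (\bigcap_n S n).
  apply: nonincreasing_cvg_mu => //.
  - by have [n ->] := mint _ (SP 0).1; rewrite ltry.
  - by move=> n; have [] := SP n.
  - by move=> i j ij; rewrite subsetEset; exact: nS.
have S1 : (1%:E <= m (\bigcap_n S n))%E.
  rewrite -(cvg_lim _ cS)//; apply: lime_ge; first by apply/cvg_ex; eexists; exact: cS.
  by apply: nearW => n; have [? ?] := SP n; exact: m1.
have S0 : (0 < m (\bigcap_n S n))%E by rewrite (lt_le_trans _ S1)// lte_fin.
have [p Sp] : \bigcap_n S n !=set0.
  by apply/set0P/eqP => S00; move: S0; rewrite S00 measure0 ltxx.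
exists p; first exact: (Sp 0 I).
rewrite (_ : [set p] = \bigcap_n S n)//.
apply/seteqP; split => [_ ->//|x Sx]; apply: V_sep => n.
have /= := Sp n.+1 I; have /= := Sx n.+1 I.
by case: ifP => _ [_ Vx] [_ Vp].
Qed.

Lemma le_mseries (m : {measure set X -> \bar R}^nat) i (A : set X) :
  (m i A <= mseries m 0 A)%E.
Proof.
apply: (@le_trans _ _ (\sum_(0 <= k < i.+1) m k A)%E).
  by rewrite big_nat_recr//= leeDr// sume_ge0.
exact: nneseries_lim_ge.
Qed.

Variable eta : {measure set X -> \bar R}.
Hypothesis eta_counting : counting_measure eta.

Lemma counting_measure_hit B : measurable B ->
  (0 < eta B)%E <-> exists2 p, B p & atoms eta p.
Proof.
move=> mB; split => [|[p Bp p0]]; last first.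
  apply: (lt_le_trans p0); rewrite le_measure ?inE//; last by move=> _ ->.
  exact: measurable_set1_separated.
have [m [mint mE]] := eta_counting; rewrite mE// => B0.
have [i mi0] : exists i, (0 < m i B)%E.
  apply: contrapT => /forallNP m0; move: B0; rewrite /mseries eseries0 ?ltxx//.
  move=> i _ _; apply/eqP; rewrite eq_le measure_ge0 andbT leNgt.
  by apply/negP; exact: m0.
have [p Bp p0] := integer_valued_measure_atom (mint i) mB mi0.
exists p => //; rewrite /atoms/= mE; last exact: measurable_set1_separated.
exact: lt_le_trans p0 (le_mseries _ _ _).
Qed.

Lemma atom_mass_ge1 p : atoms eta p -> (1 <= eta [set p])%E.
Proof.
have [m [mint mE]] := eta_counting.
have mp := measurable_set1_separated p.
rewrite /atoms/= mE// => p0.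
have [i mi0] : exists i, (0 < m i [set p])%E.
  apply: contrapT => /forallNP m0; move: p0; rewrite /mseries eseries0 ?ltxx//.
  move=> i _ _; apply/eqP; rewrite eq_le measure_ge0 andbT leNgt.
  by apply/negP; exact: m0.
apply: le_trans (le_mseries m i _); have [[|n] mi] := mint i _ mp.
  by rewrite mi ltxx in mi0.
by rewrite mi lee_fin ler1n.
Qed.

End atoms_of_counting_measures.

Section atoms_countable.
Context {R : realType} {dX : measure_display} {X : measurableType dX}.
Variable V : nat -> set X.
Hypothesis mV : forall n, measurable (V n).
Hypothesis V_sep : forall x y, (forall n, V n x <-> V n y) -> x = y.

Lemma finite_atoms (eta : {measure set X -> \bar R}) B :
  (forall p, atoms eta p -> (1 <= eta [set p])%E) ->
  measurable B -> (eta B < +oo)%E -> finite_set (atoms eta `&` B).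
Proof.
move=> eta1 mB Boo; apply: contrapT => infB.
have [r E] : exists r, eta B = r%:E.
  by exists (fine (eta B)); rewrite fineK// ge0_fin_numE.
have [J JB rJ] := infinite_set_fset (Num.truncn r).+1 infB.
have m1 p : measurable [set p] := measurable_set1_separated mV V_sep p.
have : (eta (\big[setU/set0]_(p <- finmap.enum_fset J) [set p]) <= eta B)%E.
  apply: le_measure; rewrite ?inE//.
    by elim/big_ind : _ => // C C' mC mC'; exact: measurableU.
  rewrite big_seq_cond; elim/big_ind : _ => //; first by move=> C C' CB C'B x [/CB|/C'B].
  by move=> p /andP[pJ _] _ ->; have [] := JB p pJ.
rewrite measure_fbigsetU//; last first.
  by apply/trivIsetP => p p' _ _ pp'; apply/seteqP; split => // x [-> /= E']; move: pp'; rewrite E' eqxx.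
rewrite leNgt => /negP; apply.
apply: (@lt_le_trans _ _ (\sum_(p <- finmap.enum_fset J) 1)%E).
  rewrite E sumEFin lte_fin big_const_seq count_predT iter_addr addr0.
  by rewrite (lt_le_trans (truncnS_gt r))// ler_nat.
rewrite [leLHS]big_seq_cond [leRHS]big_seq_cond; apply: lee_sum => p /andP[pJ _].
by apply: eta1; have [] := JB p pJ.
Qed.

Lemma countable_atoms (eta : {measure set X -> \bar R}) :
  counting_measure eta -> countable (atoms eta).
Proof.
move=> [m [mint mE]].
have m1 p : measurable [set p] := measurable_set1_separated mV V_sep p.
apply: (@sub_countable _ _ _ (\bigcup_i (atoms (m i) `&` setT))).
  apply: subset_card_le => p; rewrite /atoms/= mE// => p0.
  apply: contrapT => np; move: p0; rewrite /mseries eseries0 ?ltxx//.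
  move=> i _ _; apply/eqP; rewrite eq_le measure_ge0 andbT leNgt.
  by apply/negP => p0; apply: np; exists i.
apply: bigcup_countable => // i _; apply: finite_set_countable.
apply: finite_atoms => // [p p0|].
  by move: p0; rewrite /atoms/=; have [[|n] ->] := mint i _ (m1 p);
    rewrite ?ltxx// lee_fin ler1n.
by have [n ->] := mint i _ measurableT; rewrite ltry.
Qed.

End atoms_countable.

(** * Separability of the measure algebra *)

Section separable_measure_algebra.
Context {R : realType} {dY : measure_display} {Y : measurableType dY}.
Variable mu : {finite_measure set Y -> \bar R}.

Lemma measurable_setY (A B : set Y) : measurable A -> measurable B ->
  measurable (A `+` B).
Proof. by move=> mA mB; apply: measurableU; exact: measurableD. Qed.

Lemma vol_setY_triangle (A B C : set Y) : measurable A -> measurable B ->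
  measurable C -> vol mu (A `+` C) <= vol mu (A `+` B) + vol mu (B `+` C).
Proof.
move=> mA mB mC; apply: le_trans (vol_setU_le mu _ _); try exact: measurable_setY.
apply: le_vol; [exact: measurable_setY|by apply: measurableU; exact: measurable_setY|].
move=> x [[Ax nC]|[Cx nA]]; have [Bx|nB] := pselect (B x).
- by right; left.
- by left; left.
- by left; right.
- by right; right.
Qed.

Lemma vol_le_setY (A B : set Y) : measurable A -> measurable B ->
  vol mu A <= vol mu B + vol mu (A `+` B).
Proof.
move=> mA mB; apply: le_trans (vol_setU_le mu mB (measurable_setY mA mB)).
apply: le_vol => //; first by apply: measurableU => //; exact: measurable_setY.
by move=> x Ax; have [Bx|nB] := pselect (B x); [left|right; left].
Qed.

Variable G : nat -> set Y.
Hypothesis mG : forall n, measurable (G n).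
Hypothesis G_gen : @measurable _ Y `<=` <<s range G >>.

(** Countably many sets closed under finite unions and complements: a node is
the complement of the union of its children. *)
Fixpoint region (t : GenTree.tree nat) : set Y :=
  match t with
  | GenTree.Leaf n => G n
  | GenTree.Node _ ts => ~` foldr (fun t S => region t `|` S) set0 ts
  end.

Lemma measurable_region t : measurable (region t).
Proof.
move: t; fix IH 1 => -[n|n ts] /=; first exact: mG.
apply: measurableC; elim: ts => [|t ts mts] /=; first exact: measurable0.
by apply: measurableU => //; exact: IH.
Qed.

Let approx C := measurable C /\
  forall e, 0 < e -> exists t, vol mu (C `+` region t) < e.

Let approxU C C' : approx C -> approx C' -> approx (C `|` C').
Proof.
move=> [mC aC] [mC' aC']; split; first exact: measurableU.
move=> e e0; have e2 : 0 < e / 2 by rewrite divr_gt0.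
have [t Ct] := aC _ e2; have [t' Ct'] := aC' _ e2.
exists (GenTree.Node 0 [:: GenTree.Node 0 [:: t; t']]).
rewrite /= !setU0 setCK [e]splitr.
have mt := measurable_region t; have mt' := measurable_region t'.
have m1 := measurable_setY mC mt; have m2 := measurable_setY mC' mt'.
apply: le_lt_trans (ltrD Ct Ct'); apply: le_trans (vol_setU_le mu m1 m2).
apply: le_vol; [|exact: measurableU|].
  by apply: measurable_setY; exact: measurableU.
move=> x [[[Cx|C'x] /not_orP[nt nt']]|[[tx|t'x] /not_orP[nC nC']]].
- by left; left.
- by right; left.
- by left; right.
- by right; right.
Qed.

Let approx_sigma_algebra : sigma_algebra setT approx.
Proof.
split.
- split=> // e e0; exists (GenTree.Node 0 [:: GenTree.Node 0 [::]]).
  by rewrite /= setU0 setCK setY0 vol0.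
- move=> C [mC aC]; rewrite setTD; split; first exact: measurableC.
  move=> e /aC[t Ct]; exists (GenTree.Node 0 [:: t]); rewrite /= setU0.
  suff -> : ~` C `+` ~` region t = C `+` region t by [].
  by rewrite /setY !setDE !setCK setUC; congr (_ `|` _); rewrite setIC.
- move=> C aC; have mC n : measurable (C n) by have [] := aC n.
  have mUC : measurable (\bigcup_n C n) by exact: bigcup_measurable.
  split=> // e e0; have e2 : 0 < e / 2 by rewrite divr_gt0.
  pose S n := \big[setU/set0]_(i < n) C i.
  have aS n : approx (S n).
    rewrite /S; elim: n => [|n IH].
      rewrite big_ord0; split=> // e' e'0.
      exists (GenTree.Node 0 [:: GenTree.Node 0 [::]]).
      by rewrite /= setU0 setCK setY0 vol0.
    by rewrite big_ord_recr; exact: approxU.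
  have mS n : measurable (S n) by have [] := aS n.
  have US : \bigcup_n S n = \bigcup_n C n.
    apply/seteqP; split => [x [n _]|x [n _ Cx]]; first exact: bigsetU_bigcup.
    by exists n.+1 => //; rewrite /S big_ord_recr/=; right.
  have cS : vol mu (S n) @[n --> \oo] --> vol mu (\bigcup_n C n).
    apply: fine_cvg; rewrite fineK ?fin_num_measure// -US.
    apply: nondecreasing_cvg_mu => //; first by rewrite US.
    by move=> i j ij; rewrite subsetEset; exact: subset_bigsetU.
  have [n SC] : exists n, vol mu (\bigcup_n C n) - vol mu (S n) < e / 2.
    have /cvgrPdist_lt/(_ _ e2)[n _ /(_ n (leqnn n))] := cS.
    by move=> /(le_lt_trans (ler_norm _)) ?; exists n.
  have [_ /(_ _ e2)[t St]] := aS n; exists t.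
  have mt := measurable_region t.
  rewrite [e]splitr.
  apply: le_lt_trans (vol_setY_triangle mUC (mS n) mt) _.
  rewrite ltrD//; suff -> : \bigcup_n C n `+` S n = \bigcup_n C n `\` S n.
    move: SC; rewrite (volID mu mUC (mS n)) setIidr; first lra.
    by rewrite -US; exact: bigcup_sup.
  rewrite /setY (_ : S n `\` _ = set0) ?setU0// setD_eq0 -US.
  exact: bigcup_sup.
Qed.

(** The sets that the algebra approximates in volume form a sigma-algebra, which
contains the generators. *)
Lemma separable_measure_algebra : exists D : nat -> set Y,
  (forall j, measurable (D j)) /\
  forall C (e : R), measurable C -> 0 < e -> exists j, vol mu (C `+` D j) < e.
Proof.
exists (fun j => if unpickle j is Some t then region t else set0); split.
  by move=> j; case: unpickle => // t; exact: measurable_region.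
move=> C e mC; have : approx C.
  move: C mC; apply: subset_trans G_gen _; apply: smallest_sub => //.
  move=> _ [n _ <-]; split => // {}e e0; exists (GenTree.Leaf n).
  by rewrite /= setYK vol0.
by move=> [_] /[apply] -[t Ct]; exists (pickle t); rewrite pickleK.
Qed.

End separable_measure_algebra.

(** * Exponential moments and their limits *)

Section exponential_moments.
Context {R : realType} {dT : measure_display} {T : measurableType dT}.
Variable P : probability T R.

Definition mean (H : T -> R) : R := fine (\int[P]_w (H w)%:E).

Lemma bounded_integrable (H : T -> R) (M : R) :
  measurable_fun setT H -> (forall w, `|H w| <= M) ->
  P.-integrable setT (EFin \o H).
Proof.
move=> mH HM; apply: measurable_bounded_integrable => //.
  by rewrite -ge0_fin_numE// fin_num_measure.
exists M; split; first exact: num_real.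
by move=> x Mx w _ /=; exact: le_trans (HM w) (ltW Mx).
Qed.

Lemma meanK (H : T -> R) (M : R) : measurable_fun setT H ->
  (forall w, `|H w| <= M) -> (\int[P]_w (H w)%:E)%E = (mean H)%:E.
Proof.
move=> mH HM; rewrite /mean fineK//.
by have /(integrable_fin_num measurableT) := bounded_integrable mH HM.
Qed.

Lemma mean_cvg (H_ : nat -> T -> R) (H : T -> R) (M : R) :
  (forall n, measurable_fun setT (H_ n)) -> measurable_fun setT H ->
  (forall n w, `|H_ n w| <= M) ->
  {ae P, forall w, H_ ^~ w @ \oo --> H w} ->
  mean (H_ n) @[n --> \oo] --> mean H.
Proof.
move=> mH_ mH H_M H_H.
have [] := @dominated_convergence _ _ _ P setT measurableT
  (fun n => EFin \o H_ n) (EFin \o H) (EFin \o cst M).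
- by move=> n; exact/measurable_EFinP.
- exact/measurable_EFinP.
- apply: filterS H_H => w Hw _; apply: cvg_EFin Hw.
  by apply: nearW => n.
- exact: finite_measure_integrable_cst.
- by apply: aeW => w n _ /=; rewrite lee_fin.
move=> /(integrable_fin_num measurableT) Hfin _ cH.
by apply: fine_cvg; rewrite /mean fineK.
Qed.

(** [log E e^(l (H - E H)) <= v], for [l] of either sign. *)
Definition exp_moment_bound (l v : R) (H : T -> R) : Prop :=
  mean (fun w => expR (l * H w)) <= expR (l * mean H + v).

Lemma exp_moment_bound_cvg (H_ : nat -> T -> R) (H : T -> R) (l M v : R) v_ :
  (forall n, measurable_fun setT (H_ n)) -> measurable_fun setT H ->
  (forall n w, `|H_ n w| <= M) ->
  {ae P, forall w, H_ ^~ w @ \oo --> H w} ->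
  v_ n @[n --> \oo] --> v ->
  (forall n, exp_moment_bound l (v_ n) (H_ n)) -> exp_moment_bound l v H.
Proof.
move=> mH_ mH H_M H_H v_v bH.
have mexp (K : T -> R) : measurable_fun setT K ->
    measurable_fun setT (fun w => expR (l * K w)).
  by move=> mK; apply: measurableT_comp => //; exact: measurable_funM.
have cvg_expR (u : nat -> R) x : u n @[n --> \oo] --> x ->
    expR (u n) @[n --> \oo] --> expR x.
  by apply: continuous_cvg; exact: continuous_expR.
have M0 (w : T) : 0 <= M by rewrite (le_trans _ (H_M 0%N w)).
have c1 : mean (fun w => expR (l * H_ n w)) @[n --> \oo]
    --> mean (fun w => expR (l * H w)).
  apply: (@mean_cvg (fun n w => expR (l * H_ n w)) _ (expR (`|l| * M))).
  - by move=> n; exact: mexp.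
  - exact: mexp.
  - move=> n w; rewrite ger0_norm ?expR_ge0// ler_expR.
    by rewrite (le_trans (ler_norm _))// normrM ler_wpM2l.
  apply: filterS H_H => w Hw.
  by apply: cvg_expR; apply: cvgM => //; exact: cvg_cst.
have c2 : expR (l * mean (H_ n) + v_ n) @[n --> \oo] --> expR (l * mean H + v).
  apply: cvg_expR; apply: cvgD => //; apply: cvgM; first exact: cvg_cst.
  exact: mean_cvg H_H.
by apply: (ler_cvg_to c1 c2); apply: nearW => n; exact: bH.
Qed.

End exponential_moments.

(** * Coverage by the atoms of a Poisson process *)

Section finite_unions.
Context {R : realType} {dY : measure_display} {Y : measurableType dY}.
Variable mu : {finite_measure set Y -> \bar R}.

Lemma measurable_bigsetU_seq (I : Type) (s : seq I) (A : I -> set Y) :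
  (forall i, measurable (A i)) -> measurable (\big[setU/set0]_(i <- s) A i).
Proof. by move=> mA; elim/big_ind : _ => // B C; exact: measurableU. Qed.

Lemma vol_bigsetU_le (I : eqType) (s : seq I) (A B : I -> set Y) (e : R) :
  (forall i, measurable (A i)) -> (forall i, measurable (B i)) ->
  (forall i, i \in s -> vol mu (A i `+` B i) <= e) ->
  vol mu (\big[setU/set0]_(i <- s) A i)
  <= vol mu (\big[setU/set0]_(i <- s) B i) + (size s)%:R * e.
Proof.
move=> mA mB ABe.
have mbA := measurable_bigsetU_seq _ mA; have mbB := measurable_bigsetU_seq _ mB.
apply: le_trans (vol_le_setY mu (mbA s) (mbB s)) _; rewrite lerD2l.
elim: s ABe => [|i s IH] ABe; first by rewrite !big_nil setYK vol0 mul0r.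
have mAB := measurable_setY (mA i) (mB i).
have mABs := measurable_setY (mbA s) (mbB s).
rewrite !big_cons /= -natr1 mulrDl mul1r addrC.
apply: (@le_trans _ _ (vol mu (A i `+` B i) + vol mu
    ((\big[setU/set0]_(j <- s) A j) `+` (\big[setU/set0]_(j <- s) B j)))).
  apply: le_trans (vol_setU_le mu mAB mABs); apply: le_vol; last first.
  - move=> x [[[Ax|Ax] /not_orP[nB nBs]]|[[Bx|Bx] /not_orP[nA nAs]]].
    + by left; left.
    + by right; left.
    + by left; right.
    + by right; right.
  - exact: measurableU.
  - by apply: measurable_setY; exact: measurableU.
apply: lerD; first by apply: ABe; rewrite mem_head.
by apply: IH => j js; apply: ABe; rewrite in_cons js orbT.
Qed.

Lemma vol_bigcup_finite_lt (I : choiceType) (S : set I) (A : I -> set Y) (a : R) :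
  (forall i, measurable (A i)) -> countable S ->
  a < vol mu (\bigcup_(i in S) A i) ->
  exists2 s : seq I, [set` s] `<=` S & a < vol mu (\big[setU/set0]_(i <- s) A i).
Proof.
move=> mA cS; have [->|S0] := eqVneq S set0.
  by rewrite bigcup_set0 => ?; exists [::]; rewrite ?big_nil.
move: cS => /pfcard_geP[SE|[f]]; first by rewrite SE eqxx in S0.
have fS n : S (f n) by exact: funS.
pose U n := \big[setU/set0]_(i < n) A (f i).
have mU n : measurable (U n) by exact: measurable_bigsetU_seq.
have UE : \bigcup_n U n = \bigcup_(i in S) A i.
  apply/seteqP; split => [x [n _ Ux]|x [i Si Aix]].
    have [k _ Ax] := @bigsetU_bigcup _ (fun k => A (f k)) n x Ux.
    by exists (f k) => //; exact: fS.
  have [n _ fn] : (f @` setT) i by exact: surj.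
  by exists n.+1 => //; rewrite /U big_ord_recr/= fn; right.
have mUU : measurable (\bigcup_n U n) by exact: bigcup_measurable.
have cU : vol mu (U n) @[n --> \oo] --> vol mu (\bigcup_(i in S) A i).
  apply: fine_cvg; rewrite -UE fineK ?fin_num_measure//.
  apply: nondecreasing_cvg_mu => //.
  by move=> i j ij; rewrite subsetEset; exact: (@subset_bigsetU _ (fun k => A (f k))).
move=> aS; have e0 : 0 < vol mu (\bigcup_(i in S) A i) - a by rewrite subr_gt0.
have /cvgrPdist_lt/(_ _ e0)[n _ near_n] := cU.
have /= h := near_n n (leqnn n).
exists [seq f i | i <- iota 0 n].
  by move=> _ /= /mapP[k _ ->].
rewrite big_map -[n in iota _ n]subn0 -/(index_iota 0 n) big_mkord.
by have := le_lt_trans (ler_norm _) h; rewrite -/(U n); lra.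
Qed.

End finite_unions.

Section coverage_by_atoms.
Context {R : realType} {dX dY dT : measure_display}.
Context {X : measurableType dX} {Y : measurableType dY} {T : measurableType dT}.
Variable mu : {finite_measure set Y -> \bar R}.
Variable eta : T -> {measure set X -> \bar R}.
Hypothesis m_eta : forall B, measurable B -> measurable_fun setT (fun w => eta w B).
Hypothesis eta_counting : forall w, counting_measure (eta w).
Variable V : nat -> set X.
Hypothesis mV : forall n, measurable (V n).
Hypothesis V_sep : forall x y, (forall n, V n x <-> V n y) -> x = y.
Variable C : X -> set Y.
Hypothesis mC : forall p, measurable (C p).
Hypothesis mCD : forall D, measurable D ->
  measurable_fun setT (fun p => vol mu (C p `+` D)).
Variable D : nat -> set Y.
Hypothesis mD : forall j, measurable (D j).
Hypothesis D_dense : forall B (e : R), measurable B -> 0 < e ->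
  exists j, vol mu (B `+` D j) < e.

Definition covered (S : set X) (w : T) : R :=
  vol mu (\bigcup_(p in atoms (eta w) `&` S) C p).

Definition close_to (j : nat) (e : R) : set X := [set p | vol mu (C p `+` D j) < e].

Lemma measurable_close_to j e : measurable (close_to j e).
Proof.
rewrite -[close_to j e]setTI (_ : close_to j e =
  (fun p => vol mu (C p `+` D j)) @^-1` `]-oo, e[%classic).
  exact: mCD.
by apply/seteqP; split => p /=; rewrite in_itv.
Qed.

Lemma countable_atomsI S w : countable (atoms (eta w) `&` S).
Proof.
apply: sub_countable (countable_atoms mV V_sep (eta_counting w)).
by apply: subset_card_le; exact: subIsetl.
Qed.

Lemma measurable_atoms_cover S w :
  measurable (\bigcup_(p in atoms (eta w) `&` S) C p).
Proof.
have [->|S0] := eqVneq (atoms (eta w) `&` S) set0; first by rewrite bigcup_set0.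
have := countable_atomsI S w.
move=> /pfcard_geP[SE|[f]]; first by rewrite SE eqxx in S0.
rewrite (_ : \bigcup_(p in _) C p = \bigcup_n C (f n)); first exact: bigcup_measurable.
apply/seteqP; split => [x [p Sp Cx]|x [n _ Cx]]; last by exists (f n) => //; exact: funS.
have [n _ fn] : (f @` setT) p by exact: surj.
by exists n => //; rewrite fn.
Qed.

(** More than [a] is covered when finitely many atoms cover more than [a], which
is seen from the masses of countably many sets [close_to j e `&` S]: this makes
[covered S] measurable even where the atoms are dense. *)
Lemma measurable_covered S : measurable S -> measurable_fun setT (covered S).
Proof.
move=> mS; apply: (@measurability _ _ _ _ _ _ _ (RGenOInfty.measurableE R)) => _ [_ [a ->] <-].
rewrite setTI.
pose good (i : seq nat * nat) :=
  a + (size i.1)%:R * i.2.+1%:R^-1 < vol mu (\big[setU/set0]_(j <- i.1) D j).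
pose hit (i : seq nat * nat) := \bigcap_(j in [set` i.1])
  [set w | (0 < eta w (close_to j i.2.+1%:R^-1 `&` S))%E].
have mclose j e : measurable (close_to j e `&` S).
  by apply: measurableI => //; exact: measurable_close_to.
have -> : covered S @^-1` `]a, +oo[%classic = \bigcup_(i in [set i | good i]) hit i.
  apply/seteqP; split => [w /=|w [[js n] /= gi hi]]; rewrite in_itv/= andbT.
    move=> aF; have [ps psS aps] :=
      vol_bigcup_finite_lt mC (countable_atomsI S w) aF.
    have [n ne] : exists n : nat, a + 2 * (size ps)%:R * n.+1%:R^-1 <
        vol mu (\big[setU/set0]_(p <- ps) C p).
      set v := vol mu _ in aps *.
      have v0 : 0 < v - a by rewrite subr_gt0.
      exists (Num.truncn (2 * (size ps)%:R / (v - a))).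
      set k := Num.truncn _.
      have k0 : 0 < k.+1%:R :> R by rewrite ltr0n.
      suff : 2 * (size ps)%:R / k.+1%:R < v - a by rewrite ltrBrDl.
      rewrite ltr_pdivrMr// [ltRHS]mulrC -ltr_pdivrMr//; exact: truncnS_gt.
    have e0 : 0 < n.+1%:R^-1 :> R by rewrite invr_gt0 ltr0n.
    pose f p := sval (cid (D_dense (mC p) e0)).
    have fP p : vol mu (C p `+` D (f p)) < n.+1%:R^-1 by exact: (svalP (cid (D_dense (mC p) e0))).
    exists (map f ps, n); rewrite /good/hit/= ?size_map.
      have := @vol_bigsetU_le _ _ _ mu _ ps C (fun p => D (f p)) n.+1%:R^-1 mC
        (fun p => mD (f p)) (fun p _ => ltW (fP p)).
      rewrite big_map; move: ne; rewrite -mulrA.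
      by move: (vol mu _) (vol mu _) ((size ps)%:R / _) => x y z; lra.
    move=> _ /= /mapP[p pps ->]; have [/= pa Sp] := psS p pps.
    apply/(counting_measure_hit mV V_sep (eta_counting w) (mclose _ _)).
    by exists p => //; split => //; exact: fP.
  have pick j : exists p, j \in js ->
      [/\ atoms (eta w) p, S p & close_to j n.+1%:R^-1 p].
    have [jjs|njs] := boolP (j \in js); last by exists point.
    have /= := hi _ jjs.
    move=> /(counting_measure_hit mV V_sep (eta_counting w) (mclose _ _)).
    by move=> [p [pj Sp] ap]; exists p.
  pose g j := sval (cid (pick j)).
  have gP j : j \in js -> [/\ atoms (eta w) (g j), S (g j) & close_to j n.+1%:R^-1 (g j)].
    by move=> jjs; exact: (svalP (cid (pick j))).
  apply: (@lt_le_trans _ _ (vol mu (\big[setU/set0]_(j <- js) C (g j)))); last first.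
    apply: le_vol; [exact: measurable_bigsetU_seq|exact: measurable_atoms_cover|].
    rewrite big_seq_cond; elim/big_ind : _ => //.
      by move=> A B AC BC x [/AC|/BC].
    by move=> j; rewrite andbT => /gP[ga gS _] x Cx; exists (g j).
  have h j : j \in js -> vol mu (D j `+` C (g j)) <= n.+1%:R^-1.
    by move=> /gP[_ _]; rewrite setYC => /ltW.
  have := @vol_bigsetU_le _ _ _ mu _ js D (fun j => C (g j)) n.+1%:R^-1 mD
    (fun p => mC (g p)) h.
  by move: gi; rewrite /good/= => gi /(lt_le_trans gi); rewrite ltrD2r.
rewrite bigcup_mkcond; apply: countable_bigcupT_measurable; first exact: countableP.
move=> i; case: ifPn => // _.
apply: fin_bigcap_measurable => // j _.
rewrite -[X in measurable X]setTI.
exact: (emeasurable_fun_o_infty measurableT (m_eta (mclose _ _))).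
Qed.

Lemma coveredT w : covered setT w = vol mu (\bigcup_(p in atoms (eta w)) C p).
Proof. by rewrite /covered setIT. Qed.

Lemma covered_itv S w : 0 <= covered S w <= vol mu setT.
Proof.
rewrite vol_ge0/=; apply: le_vol => //; exact: measurable_atoms_cover.
Qed.

End coverage_by_atoms.

Section poisson_counts.
Context {R : realType} {dX dT : measure_display}.
Context {X : measurableType dX} {T : measurableType dT}.
Variables (P : probability T R) (nu : set X -> \bar R).
Variable eta : T -> {measure set X -> \bar R}.
Hypothesis eta_poisson : poisson_process P nu eta.

Let m_eta B : measurable B -> measurable_fun setT (fun w => eta w B).
Proof. by move=> mB; exact: (poisson_process_measurable eta_poisson). Qed.

Lemma measurable_hit B : measurable B -> measurable [set w | (0 < eta w B)%E].
Proof.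
move=> mB; rewrite -[X in measurable X]setTI.
exact: (emeasurable_fun_o_infty measurableT (m_eta mB)).
Qed.

Let poisson_count B (r : R) (n : nat) : measurable B -> nu B = r%:E ->
  P [set w | eta w B = n%:R%:E] = (r ^+ n / n`!%:R * expR (- r))%:E.
Proof.
move=> mB nuB; have := poisson_process_poisson eta_poisson mB.
by rewrite /poisson_distributed nuB.
Qed.

Let measurable_count B (n : nat) : measurable B ->
  measurable [set w | eta w B = n%:R%:E].
Proof.
move=> mB; rewrite -[X in measurable X]setTI.
by have := m_eta mB measurableT (emeasurable_set1 n%:R%:E).
Qed.

Lemma poisson_null B : measurable B -> nu B = 0%E ->
  {ae P, forall w, eta w B = 0%E}.
Proof.
move=> mB nuB; exists (~` [set w | eta w B = 0%:R%:E]); split => //.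
  exact/measurableC/measurable_count.
have m0 := measurable_count 0 mB.
rewrite probability_setC// (poisson_count 0 mB nuB).
by rewrite expr0 fact0 divr1 oppr0 expR0 mulr1 subee.
Qed.

(** The probabilities of the finite counts add up to [1]. *)
Lemma poisson_ae_finite B : measurable B -> (0 <= nu B)%E -> (nu B < +oo)%E ->
  {ae P, forall w, (eta w B < +oo)%E}.
Proof.
move=> mB nu0 nuoo.
have [r nuB] : exists r, nu B = r%:E by exists (fine (nu B)); rewrite fineK// ge0_fin_numE.
have r0 : 0 <= r by rewrite -lee_fin -nuB.
pose E n := [set w | eta w B = n%:R%:E].
have mE n : measurable (E n) by exact: measurable_count.
have mUE : measurable (\bigcup_n E n) by exact: bigcup_measurable.
have tE : trivIset setT E.
  apply/trivIsetP => i j _ _ ij; apply/seteqP; split => // w [/= Ei].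
  by rewrite /E/= Ei => -[ijR]; move: ij; rewrite -(eqr_nat R) ijR eqxx.
have PE : P (\bigcup_n E n) = 1%E.
  rewrite measure_bigcup//=.
  rewrite -[RHS](_ : (expR (- r))%:E * (expR r)%:E = 1)%E; last first.
    by rewrite -EFinM expRN mulVf ?gt_eqF ?expR_gt0.
  under eq_eseriesr do rewrite (poisson_count _ mB nuB) EFinM muleC.
  rewrite (eq_eseriesl (Q := xpredT)) ?nneseriesZl//=; last 2 first.
  - by move=> n _; rewrite lee_fin divr_ge0// exprn_ge0.
  - by move=> n; rewrite in_setT.
  congr *%E; rewrite expRE -EFin_lim; last first.
    rewrite /pseries/=; under eq_fun do rewrite mulrC.
    exact: is_cvg_series_exp_coeff.
  apply/congr_lim/funext => n/=; rewrite /pseries/= /series/= -sumEFin//.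
  by under eq_bigr do rewrite mulrC.
exists (~` \bigcup_n E n); split => //; first exact: measurableC.
  by rewrite probability_setC// PE subee.
by move=> w /= oo [n _ En]; apply: oo; rewrite En ltry.
Qed.

Lemma poisson_hit_le B (r : R) : measurable B -> nu B = r%:E ->
  (P [set w | (0 < eta w B)%E] <= nu B)%E.
Proof.
move=> mB nuB; have m0 := measurable_count 0 mB.
have -> : [set w | (0 < eta w B)%E] = ~` [set w | eta w B = 0%:R%:E].
  apply/seteqP; split => w /= => [h e0|/eqP h]; first by rewrite e0 ltxx in h.
  by rewrite lt_neqAle measure_ge0 eq_sym h.
rewrite probability_setC// (poisson_count 0 mB nuB) nuB.
rewrite expr0 fact0 divr1 mul1r -EFinB lee_fin.
by have := expR_ge1Dx (- r); lra.
Qed.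

Section prefix_independence.
Variable B : nat -> set X.
Hypothesis mB : forall i, measurable (B i).
Hypothesis tB : trivIset setT B.
Local Notation A := (fun i => [set w | (0 < eta w (B i))%E]).

Let prefix_shape N i E : prefix_event A i E -> (i <= N)%N ->
  exists C : nat -> set (\bar R), [/\ forall j, measurable (C j),
    forall j, (i <= j)%N -> C j = setT &
    E = \bigcap_(j : 'I_N) [set w | C j (eta w (B j))]].
Proof.
have step i' C0 (C : nat -> set (\bar R)) : measurable C0 ->
    (forall j, measurable (C j)) -> (forall j, (i' <= j)%N -> C j = setT) ->
    (i' < N)%N ->
    exists C' : nat -> set (\bar R), [/\ forall j, measurable (C' j),
      forall j, (i' < j)%N -> C' j = setT &
      (\bigcap_(j : 'I_N) [set w | C j (eta w (B j))]) `&`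
        [set w | C0 (eta w (B i'))]
      = \bigcap_(j : 'I_N) [set w | C' j (eta w (B j))]].
  move=> mC0 mC CT iN; exists (fun j => if j == i' then C0 else C j); split.
  - by move=> j; case: ifP.
  - by move=> j ij; rewrite gtn_eqF// CT// ltnW.
  apply/seteqP; split => [w [Cw C0w] j _ /=|w Cw].
    by case: eqVneq => [->//|_]; exact: Cw.
  split => [j _ /=|/=]; last by have /= := Cw (Ordinal iN) I; rewrite eqxx.
  have /= := Cw j I; case: eqVneq => // ji _.
  by rewrite CT// ji.
elim=> [_|{}i {}E _ IH iN|{}i {}E _ IH iN].
- by exists (fun=> setT); split => //; apply/seteqP; split.
- have [C [mC CT ->]] := IH (ltnW iN).
  have [C' [mC' CT' E']] := step i `]0%E, +oo[%classic C (emeasurable_itv _) mC CT iN.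
  exists C'; split => //; rewrite -E'; congr (_ `&` _).
  by apply/seteqP; split => w /=; rewrite in_itv/= andbT.
- have [C [mC CT ->]] := IH (ltnW iN).
  have [C' [mC' CT' E']] := step i (~` `]0%E, +oo[%classic) C
    (measurableC (emeasurable_itv _)) mC CT iN.
  exists C'; split => //; rewrite -E' setDE; congr (_ `&` _).
  by apply/seteqP; split => w /=; rewrite in_itv/= andbT.
Qed.

(** A prefix event constrains the counts of the disjoint sets [B j], trivially for
the sets that come later; adding one more constraint changes one factor in the
product of probabilities. *)
Lemma poisson_prefix_independent N i E : (i < N)%N -> prefix_event A i E ->
  P (E `&` A i) = (P E * P (A i))%E.
Proof.
move=> iN /[dup] /prefix_shape -/(_ N (ltnW iN))[C [mC CT EE]] pE.
have indep C' : (forall j, measurable (C' j)) ->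
    P (\bigcap_(j : 'I_N) [set w | C' j (eta w (B j))])
    = (\prod_(j < N) P [set w | C' j (eta w (B j))])%E.
  move=> mC'; apply: (poisson_process_independent eta_poisson
    (B := fun j : 'I_N => B j) _ _ (C := fun j : 'I_N => C' j)) => //.
  by apply/trivIsetP => j k _ _ jk; move/trivIsetP : tB; apply.
pose C1 j := if j == i then `]0%E, +oo[%classic else C j.
have mC1 j : measurable (C1 j) by rewrite /C1; case: ifP => // _; exact: emeasurable_itv.
have -> : E `&` A i = \bigcap_(j : 'I_N) [set w | C1 j (eta w (B j))].
  rewrite EE; apply/seteqP; split => [w [Cw /= Aw] j _ /=|w Cw].
    by rewrite /C1; case: eqVneq => [->|_]; [rewrite /= in_itv/= Aw|exact: Cw].
  split => [j _ /=|/=].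
    have /= := Cw j I; rewrite /C1; case: eqVneq => // ji _.
    by rewrite CT// ji.
  by have /= := Cw (Ordinal iN) I; rewrite /C1 eqxx /= in_itv/= andbT.
rewrite EE (indep C mC) (indep C1 mC1) [in LHS](bigD1 (Ordinal iN))//= [in RHS](bigD1 (Ordinal iN))//=.
rewrite CT// (_ : [set w | setT _] = setT); last by apply/seteqP; split.
rewrite probability_setT mul1e muleC; congr (_ * _)%E.
  apply: eq_bigr => j /eqP ji; rewrite /C1 ifF//; apply/negP => /eqP ji'.
  by apply: ji; exact: val_inj.
by congr (P _); apply/seteqP; split => w /=; rewrite /C1 eqxx /= in_itv/= andbT.
Qed.

End prefix_independence.

End poisson_counts.

Section poisson_coverage.
Context {R : realType} {dX dY dT : measure_display}.
Context {X : measurableType dX} {Y : measurableType dY} {T : measurableType dT}.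
Variable mu : {finite_measure set Y -> \bar R}.
Variables (P : probability T R) (nu : {measure set X -> \bar R}).
Variable eta : T -> {measure set X -> \bar R}.
Hypothesis eta_poisson : poisson_process P nu eta.
Variable V : nat -> set X.
Hypothesis mV : forall n, measurable (V n).
Hypothesis V_sep : forall x y, (forall n, V n x <-> V n y) -> x = y.
Variable C : X -> set Y.
Hypothesis mC : forall p, measurable (C p).
Hypothesis mCD : forall D, measurable D ->
  measurable_fun setT (fun p => vol mu (C p `+` D)).
Variable D : nat -> set Y.
Hypothesis mD : forall j, measurable (D j).
Hypothesis D_dense : forall B (e : R), measurable B -> 0 < e ->
  exists j, vol mu (B `+` D j) < e.

Let eta_counting w : counting_measure (eta w).
Proof. exact: (poisson_process_counting eta_poisson). Qed.

Let m_eta B : measurable B -> measurable_fun setT (fun w => eta w B).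
Proof. by move=> mB; exact: (poisson_process_measurable eta_poisson). Qed.

Let w0 := vol mu setT.

Lemma measurable_vol_C : measurable_fun setT (fun p => vol mu (C p)).
Proof.
have := mCD measurable0; congr (measurable_fun setT).
by apply/funext => p; rewrite setY0.
Qed.

Section cells.
Variables (S : set X) (e b s : R).
Hypothesis mS : measurable S.
Hypothesis nuS : (nu S < +oo)%E.
Hypothesis e_gt0 : 0 < e.
Hypothesis b_ge0 : 0 <= b.
Hypothesis C_le : forall p, S p -> vol mu (C p) <= b.
Hypothesis C_int : (\int[nu]_(p in S) (vol mu (C p))%:E <= s%:E)%E.

Definition cell : nat -> set X :=
  seqDU (fun j => close_to mu C D j e `&` S).

(** Empty cells get the empty set so that every [cell_region] has volume at most
[b + e]. *)
Definition cell_region (j : nat) : set Y :=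
  if `[< cell j !=set0 >] then D j else set0.

Definition cell_hit (j : nat) : set T := [set w | (0 < eta w (cell j))%E].

Lemma measurable_cell j : measurable (cell j).
Proof.
have m i : measurable (close_to mu C D i e `&` S).
  by apply: measurableI => //; exact: measurable_close_to.
by apply: measurableD => //; exact: bigsetU_measurable.
Qed.

Lemma measurable_cell_region j : measurable (cell_region j).
Proof. by rewrite /cell_region; case: ifP. Qed.

Lemma cellP j p : cell j p ->
  [/\ S p, vol mu (C p `+` cell_region j) < e & cell_region j = D j].
Proof.
move=> jp; have jE : cell_region j = D j.
  by rewrite /cell_region ifT//; apply/asboolP; exists p.
by have [[pD Sp] _] := jp; rewrite jE.
Qed.

Lemma bigcup_cell : \bigcup_j cell j = S.
Proof.
rewrite -seqDU_bigcup_eq -setI_bigcupl setIidr// => p _.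
by have [j pj] := D_dense (mC p) e_gt0; exists j.
Qed.

Lemma vol_cell_region_le j : vol mu (cell_region j) <= b + e.
Proof.
have [[p jp]|/asboolP] := pselect (cell j !=set0); last first.
  by rewrite asbool_neg /cell_region => /negbTE ->; rewrite vol0 addr_ge0// ltW.
have [Sp /ltW pe _] := cellP jp.
have := vol_le_setY mu (measurable_cell_region j) (mC p).
by rewrite setYC => /le_trans; apply; rewrite lerD// C_le.
Qed.

Let nu_cell_fin j : nu (cell j) \is a fin_num.
Proof.
rewrite ge0_fin_numE//; apply: le_lt_trans nuS.
apply: le_measure; rewrite ?inE//; first exact: measurable_cell.
by move=> p /cellP[].
Qed.

Lemma cell_hit_le j : ((fine (P (cell_hit j)))%:E <= nu (cell j))%E.
Proof.
rewrite fineK; last by apply: fin_num_measure; apply: (measurable_hit eta_poisson); exact: measurable_cell.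
apply: (@poisson_hit_le _ _ _ _ _ _ _ _ eta_poisson _ (fine (nu (cell j)))).
  exact: measurable_cell.
by rewrite fineK.
Qed.

(** The region of a cell exceeds each cylinder in the cell by at most [e] in
volume, which compares the sum with the integral of the cylinder volume. *)
Lemma cell_energy_le N :
  \sum_(j < N) fine (P (cell_hit j)) * vol mu (cell_region j) ^+ 2
  <= (b + e) * (s + e * fine (nu S)).
Proof.
have be : 0 <= b + e by rewrite addr_ge0// ltW.
apply: (@le_trans _ _ (\sum_(j < N) (b + e) *
    (fine (P (cell_hit j)) * vol mu (cell_region j)))).
  apply: ler_sum => j _; rewrite expr2 mulrCA ler_wpM2r//.
    by rewrite mulr_ge0// ?vol_ge0// fine_ge0.
  exact: vol_cell_region_le.
rewrite -mulr_sumr ler_wpM2l//.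
pose f p := ((vol mu (C p))%:E + e%:E)%E.
have mf : measurable_fun setT f.
  apply: emeasurable_funD => //; apply/measurable_EFinP; exact: measurable_vol_C.
have f0 p : (0 <= f p)%E by rewrite /f -EFinD lee_fin addr_ge0 ?vol_ge0// ltW.
have nuSfin : nu S \is a fin_num by rewrite ge0_fin_numE.
rewrite -lee_fin -sumEFin.
apply: (@le_trans _ _ (\sum_(j < N) \int[nu]_(p in cell j) f p)%E).
  apply: lee_sum => j _.
  apply: (@le_trans _ _ (\int[nu]_(p in cell j) (cst (vol mu (cell_region j))%:E p))%E).
    rewrite integral_cst; last exact: measurable_cell.
    rewrite EFinM muleC lee_wpmul2l ?lee_fin ?vol_ge0//; exact: cell_hit_le.
  apply: ge0_le_integral => //=; first exact: measurable_cell.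
  - by move=> p _; rewrite lee_fin vol_ge0.
  - exact: measurable_funS mf.
  move=> p /cellP[_ /ltW pe _]; rewrite /f -EFinD lee_fin.
  have := vol_le_setY mu (measurable_cell_region j) (mC p).
  by rewrite setYC => /le_trans; apply; rewrite lerD2l.
have mcell := measurable_cell.
have tcell : trivIset setT cell := trivIset_seqDU _.
rewrite -(big_mkord xpredT (fun j => \int[nu]_(p in cell j) f p)%E).
rewrite -(@ge0_integral_bigsetU _ _ _ nu _ cell f (index_iota 0 N))//; last first.
- exact: measurable_funS mf.
- exact: sub_trivIset tcell.
- exact: iota_uniq.
apply: (@le_trans _ _ (\int[nu]_(p in S) f p)%E).
  apply: ge0_subset_integral => //.
  - exact: bigsetU_measurable.
  - exact: measurable_funS mf.
  - rewrite big_mkord; apply: subset_trans (@bigsetU_bigcup _ cell N) _.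
    by rewrite bigcup_cell.
rewrite ge0_integralD//.
- rewrite integral_cst// EFinD EFinM fineK//; exact: leeD2r.
- by move=> p _; rewrite lee_fin vol_ge0.
- apply/measurable_EFinP; exact: measurable_funS measurable_vol_C.
- by move=> p _; rewrite lee_fin ltW.
Qed.

Definition cells_covered (w : T) : R :=
  vol mu (\bigcup_(j in [set j | cell_hit j w]) cell_region j).

Let m_cell_hit j : measurable (cell_hit j).
Proof. by apply: (measurable_hit eta_poisson); exact: measurable_cell. Qed.

Let H_ N := coverage mu cell_hit cell_region N 0 setT.

Let H_norm N w : `|H_ N w| <= w0.
Proof.
rewrite ger0_norm ?coverage_ge0// /H_ coverageE//; last exact: measurable_cell_region.
apply: le_vol => //; apply: measurableI => //; apply: bigcup_measurable => j _.
exact: measurable_cell_region.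
Qed.

Let H_cvg w : H_ ^~ w @ \oo --> cells_covered w.
Proof.
have mreg := measurable_cell_region.
pose U N := \bigcup_(j in [set j | (0 <= j < 0 + N)%N /\ cell_hit j w]) cell_region j.
have mU N : measurable (U N) by exact: bigcup_measurable.
have UE : \bigcup_N U N = \bigcup_(j in [set j | cell_hit j w]) cell_region j.
  apply/seteqP; split => [x [N _ [j [_ jw] jx]]|x [j jw jx]]; first by exists j.
  by exists j.+1 => //; exists j => //=; rewrite add0n ltnS leqnn.
have HE N : H_ N w = vol mu (U N).
  by rewrite /H_ coverageE// setTI.
under eq_fun do rewrite HE.
rewrite /cells_covered -UE.
have mUU : measurable (\bigcup_N U N) by exact: bigcup_measurable.
apply: fine_cvg; rewrite fineK ?fin_num_measure//.
apply: nondecreasing_cvg_mu => //.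
move=> i j ij; rewrite subsetEset => x [k [/andP[k0 ki] kw] kx].
by exists k => //; split => //; rewrite k0/= (leq_trans ki)// leq_add2l.
Qed.

Let mH N : measurable_fun setT (H_ N).
Proof. exact: measurable_coverage. Qed.

Lemma measurable_cells_covered : measurable_fun setT cells_covered.
Proof. by apply: (measurable_fun_cvg mH) => w _; exact: H_cvg. Qed.

Lemma cells_covered_norm w : `|cells_covered w| <= w0.
Proof.
rewrite ger0_norm ?vol_ge0//; apply: le_vol => //.
by apply: bigcup_measurable => j _; exact: measurable_cell_region.
Qed.

Let indep N i E : (i < N)%N -> prefix_event cell_hit i E ->
  P (E `&` cell_hit i) = (P E * P (cell_hit i))%E.
Proof.
move=> iN pE; apply: (poisson_prefix_independent eta_poisson _ _ iN) => //.
- exact: measurable_cell.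
- exact: trivIset_seqDU.
Qed.

Let mean_expE (l : R) N :
  (\int[P]_w (expR (l * H_ N w))%:E)%E = (mean P (fun w => expR (l * H_ N w)))%:E.
Proof.
apply: (@meanK _ _ _ _ _ (expR (`|l| * w0))).
  by apply: measurableT_comp => //; exact: measurable_funM.
move=> w; rewrite ger0_norm ?expR_ge0// ler_expR.
by rewrite (le_trans (ler_norm _))// normrM ler_wpM2l.
Qed.

Lemma cells_covered_upper (l : R) : 0 <= l -> l * (b + e) <= 1 / 2 ->
  exp_moment_bound P l (2 * l ^+ 2 * (b + e) * w0) cells_covered.
Proof.
move=> l0 lbe.
apply: (@exp_moment_bound_cvg _ _ _ P H_ _ l w0 _
  (fun=> 2 * l ^+ 2 * (b + e) * w0)) => //.
- exact: measurable_cells_covered.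
- by apply: aeW => w; exact: H_cvg.
- exact: cvg_cst.
move=> N; have := @coverage_mgf_upper _ _ _ mu _ _ P cell_hit cell_region
  m_cell_hit measurable_cell_region N (@indep N) l (b + e) l0 lbe
  (fun j _ => vol_cell_region_le j) (addr_ge0 b_ge0 (ltW e_gt0)).
by rewrite -/(H_ N) mean_expE lee_fin.
Qed.

Lemma cells_covered_lower (l : R) : 0 <= l ->
  exp_moment_bound P (- l) (l ^+ 2 * ((b + e) * (s + e * fine (nu S)))) cells_covered.
Proof.
move=> l0.
apply: (@exp_moment_bound_cvg _ _ _ P H_ _ (- l) w0 _
  (fun=> l ^+ 2 * ((b + e) * (s + e * fine (nu S))))) => //.
- exact: measurable_cells_covered.
- by apply: aeW => w; exact: H_cvg.
- exact: cvg_cst.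
move=> N; have := @coverage_mgf_lower _ _ _ mu _ _ P cell_hit cell_region
  m_cell_hit measurable_cell_region N (@indep N) l l0.
rewrite -/(H_ N); under eq_integral do rewrite -mulNr.
rewrite mean_expE lee_fin => /le_trans; apply.
by rewrite ler_expR mulNr lerD2l ler_wpM2l ?sqr_ge0//; exact: cell_energy_le.
Qed.

End cells.

(** Each of the finitely many atoms in [S] is replaced by the region of its cell,
at the cost of a volume less than [e] per atom. *)
Lemma cells_covered_dist S w : measurable S -> (eta w S < +oo)%E ->
  exists k : nat, forall e, 0 < e ->
  `|cells_covered S e w - covered mu eta C S w| <= k%:R * e.
Proof.
move=> mS finS.
have /finite_seqP[ps psE] : finite_set (atoms (eta w) `&` S).
  apply: (finite_atoms mV V_sep) => // p.
  exact: (atom_mass_ge1 mV V_sep (eta_counting w)).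
exists (size ps) => e e0.
have pick p : exists j, S p -> cell S e j p.
  have [Sp|nSp] := pselect (S p); last by exists 0%N.
  by move: (Sp); rewrite -{1}(bigcup_cell S e0) => -[j _ jp]; exists j.
pose g p := sval (cid (pick p)).
have gP p : S p -> cell S e (g p) p by exact: (svalP (cid (pick p))).
have psP p : (p \in ps) <-> (atoms (eta w) `&` S) p by rewrite psE.
have -> : cells_covered S e w =
    vol mu (\big[setU/set0]_(p <- ps) cell_region S e (g p)).
  rewrite /cells_covered -bigcup_seq; congr vol.
  apply/seteqP; split => [x [j jw jx]|x [p /= /psP[pa Sp] px]].
    have mj : measurable (cell S e j) by exact: measurable_cell.
    have [p jp ap] := (counting_measure_hit mV V_sep (eta_counting w) mj).1 jw.
    have [Sp _ _] := cellP jp.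
    exists p => /=; first by apply/psP.
    suff <- : j = g p by [].
    apply: contrapT => /eqP jg.
    have /trivIsetP/(_ j (g p) I I jg) : trivIset setT (cell S e) by exact: trivIset_seqDU.
    by move/seteqP => [/(_ p)/= h _]; apply: h; split => //; exact: gP.
  exists (g p) => //=; have mj : measurable (cell S e (g p)) by exact: measurable_cell.
  apply/(counting_measure_hit mV V_sep (eta_counting w) mj); exists p => //.
  exact: gP.
rewrite /covered psE bigcup_seq.
have mreg p : measurable (cell_region S e (g p)) by exact: measurable_cell_region.
have d1 p : p \in ps -> vol mu (C p `+` cell_region S e (g p)) <= e.
  by move=> /psP[_ Sp]; have [_ /ltW] := cellP (gP _ Sp).
have d2 p : p \in ps -> vol mu (cell_region S e (g p) `+` C p) <= e.
  by move=> /d1; rewrite setYC.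
have := vol_bigsetU_le mC mreg d1; have := vol_bigsetU_le mreg mC d2.
by move=> h1 h2; rewrite ler_norml; apply/andP; split; lra.
Qed.

Variables (S_ : nat -> set X) (b s : R).
Hypothesis mS_ : forall m, measurable (S_ m).
Hypothesis S_nd : forall m n, (m <= n)%N -> S_ m `<=` S_ n.
Hypothesis nuS_ : forall m, (nu (S_ m) < +oo)%E.
Hypothesis nu_out : nu (~` \bigcup_m S_ m) = 0%E.
Hypothesis b_ge0 : 0 <= b.
Hypothesis C_le : forall m p, S_ m p -> vol mu (C p) <= b.
Hypothesis C_int : forall m, (\int[nu]_(p in S_ m) (vol mu (C p))%:E <= s%:E)%E.

Let m_cov S : measurable S -> measurable_fun setT (covered mu eta C S).
Proof. exact: (measurable_covered m_eta eta_counting mV V_sep mC mCD mD D_dense). Qed.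

Let cov_norm S w : `|covered mu eta C S w| <= w0.
Proof.
have := covered_itv mu eta_counting mV V_sep mC S w.
by move=> /andP[c0 c1]; rewrite ger0_norm.
Qed.

Let covered_cvg : {ae P, forall w,
  (covered mu eta C (S_ m) w) @[m --> \oo] --> covered mu eta C setT w}.
Proof.
have mout : measurable (~` \bigcup_m S_ m).
  by apply: measurableC; exact: bigcup_measurable.
apply: filterS (poisson_null eta_poisson mout nu_out) => w out0.
have atS : atoms (eta w) `<=` \bigcup_m S_ m.
  move=> p ap; apply: contrapT => np; move: out0 => /eqP; apply/negP.
  rewrite -measure_gt0.
  by apply/(counting_measure_hit mV V_sep (eta_counting w) mout); exists p.
pose U m := \bigcup_(p in atoms (eta w) `&` S_ m) C p.
have mU m : measurable (U m) by exact: (measurable_atoms_cover eta_counting mV V_sep mC).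
have UE : \bigcup_m U m = \bigcup_(p in atoms (eta w) `&` setT) C p.
  apply/seteqP; split => [x [m _ [p [ap _] px]]|x [p [ap _] px]]; first by exists p.
  by have [m _ Sp] := atS p ap; exists m => //; exists p.
rewrite {2}/covered -UE; have mUU : measurable (\bigcup_m U m).
  by exact: bigcup_measurable.
apply: fine_cvg; rewrite fineK ?fin_num_measure//.
apply: nondecreasing_cvg_mu => //.
by move=> i j ij; rewrite subsetEset => x [p [ap Sp] px]; exists p => //; split => //; exact: S_nd Sp.
Qed.

(** Two limits: the cells shrink, then the regions of finite intensity exhaust
the space. *)
Let exp_moment_limit (l v : R) (f : R -> nat -> R) (e0 : R) : 0 < e0 ->
  (forall m (e : R), 0 < e -> e <= e0 ->
    exp_moment_bound P l (f e m) (cells_covered (S_ m) e)) ->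
  (forall m, f (e0 / n.+1%:R) m @[n --> \oo] --> v) ->
  exp_moment_bound P l v (covered mu eta C setT).
Proof.
move=> e0_gt0 bf fv.
apply: (@exp_moment_bound_cvg _ _ _ P (fun m => covered mu eta C (S_ m)) _ l w0 _
  (fun=> v)) => //.
- by move=> m; exact: m_cov.
- exact: m_cov.
- exact: cvg_cst.
move=> m.
have en n : 0 < e0 / n.+1%:R by rewrite divr_gt0.
apply: (@exp_moment_bound_cvg _ _ _ P (fun n => cells_covered (S_ m) (e0 / n.+1%:R))
   _ l w0 _ (fun n => f (e0 / n.+1%:R) m)) => //.
- by move=> n; exact: measurable_cells_covered.
- exact: m_cov.
- by move=> n w; exact: cells_covered_norm.
- apply: filterS (poisson_ae_finite eta_poisson (mS_ m) _ (nuS_ m)) => // w finw.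
  have [k kP] := cells_covered_dist (mS_ m) finw.
  apply/cvgrPdist_le => /= e e_gt0.
  have : (k%:R * e0) * n.+1%:R^-1 @[n --> \oo] --> (k%:R * e0) * 0.
    by apply: cvgM; [exact: cvg_cst|exact: cvg_harmonic].
  rewrite mulr0 => /cvgrPdist_le/(_ _ e_gt0); apply: filterS => n /=.
  rewrite sub0r normrN ger0_norm; last by rewrite !mulr_ge0// ltW.
  by rewrite -mulrA distrC; apply: le_trans; exact: kP.
move=> n; apply: bf => //.
by rewrite ler_pdivrMr// -[leLHS]mulr1 ler_wpM2l ?ler1n// ltW.
Qed.

Let cvg_eps (e0 : R) : e0 / n.+1%:R @[n --> \oo] --> (0 : R).
Proof.
rewrite -[X in _ --> X](mulr0 e0).
by apply: cvgM; [exact: cvg_cst|exact: cvg_harmonic].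
Qed.

Theorem poisson_coverage_upper (l : R) : 0 <= l -> l * b <= 1 / 4 ->
  exp_moment_bound P l (2 * l ^+ 2 * b * w0) (covered mu eta C setT).
Proof.
move=> l0 lb.
have e0_gt0 : 0 < (4 * (l + 1))^-1 by rewrite invr_gt0; lra.
apply: (@exp_moment_limit l _ (fun e _ => 2 * l ^+ 2 * (b + e) * w0) _ e0_gt0).
  move=> m e e_gt0 ee0.
  apply: (cells_covered_upper (S := S_ m)) => //; first exact: C_le.
  have : l * e <= 1 / 4.
    apply: (le_trans (ler_wpM2l l0 ee0)); rewrite ler_pdivrMr; lra.
  by rewrite mulrDr; lra.
move=> m; rewrite -[X in _ * X * _](addr0 b).
apply: cvgM; last exact: cvg_cst.
apply: cvgM; first exact: cvg_cst.
by apply: cvgD; [exact: cvg_cst|exact: cvg_eps].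
Qed.

Theorem poisson_coverage_lower (l : R) : 0 <= l ->
  exp_moment_bound P (- l) (l ^+ 2 * (b * s)) (covered mu eta C setT).
Proof.
move=> l0.
apply: (@exp_moment_limit (- l) _
  (fun e m => l ^+ 2 * ((b + e) * (s + e * fine (nu (S_ m))))) 1 ltr01).
  move=> m e e_gt0 _.
  by apply: (cells_covered_lower (S := S_ m)) => //; exact: C_le.
move=> m.
have -> : l ^+ 2 * (b * s) = l ^+ 2 * ((b + 0) * (s + 0 * fine (nu (S_ m)))).
  by rewrite mul0r !addr0.
apply: cvgM; first exact: cvg_cst.
apply: cvgM; apply: cvgD; try exact: cvg_cst; first exact: cvg_eps.
by apply: cvgM; [exact: cvg_eps|exact: cvg_cst].
Qed.

End poisson_coverage.

(** * From exponential moments to tails *)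

Section tails.
Context {R : realType} {dT : measure_display} {T : measurableType dT}.
Variables (P : probability T R) (F : T -> R) (w : R).
Hypothesis mF : measurable_fun setT F.
Hypothesis F_itv : forall x, 0 <= F x <= w.

Let F_norm x : `|F x| <= w.
Proof. by have /andP[F0 Fw] := F_itv x; rewrite ger0_norm. Qed.

Lemma expectation_mean : 'E_P[F]%E = (mean P F)%:E.
Proof. by rewrite unlock (meanK P mF F_norm). Qed.

Lemma mean_itv_ge0 : 0 <= mean P F.
Proof.
by apply: fine_ge0; apply: integral_ge0 => x _; rewrite lee_fin; case/andP: (F_itv x).
Qed.

Lemma chernoff (l v a : R) (E : set T) : measurable E ->
  exp_moment_bound P l v F ->
  E `<=` [set x | l * mean P F + a <= l * F x] ->
  (P E <= (expR (v - a))%:E)%E.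
Proof.
move=> mE bF EF; set m := mean P F in EF.
have mexp : measurable_fun setT (fun x => expR (l * F x)).
  by apply: measurableT_comp => //; exact: measurable_funM.
have exp_norm x : `|expR (l * F x)| <= expR (`|l| * w).
  rewrite ger0_norm ?expR_ge0// ler_expR.
  by rewrite (le_trans (ler_norm _))// normrM ler_wpM2l.
have PEfin : P E \is a fin_num by exact: fin_num_measure.
have : ((expR (l * m + a))%:E * P E <= (expR (l * m + v))%:E)%E.
  apply: (@le_trans _ _ (\int[P]_(x in E) (expR (l * F x))%:E)%E).
    rewrite -(@integral_cst _ _ _ P E mE); apply: ge0_le_integral => //=.
    - apply/measurable_EFinP; exact: measurable_funS mexp.
    - by move=> x /EF; rewrite lee_fin ler_expR.
  apply: (@le_trans _ _ (\int[P]_x (expR (l * F x))%:E)%E).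
    by apply: ge0_subset_integral => //; exact/measurable_EFinP.
  by rewrite (meanK P mexp exp_norm) lee_fin.
rewrite -(fineK PEfin) -EFinM !lee_fin -ler_pdivlMl ?expR_gt0//.
by rewrite -expRN -expRD; congr (_ <= expR _); ring.
Qed.

(** For [B = 0] the quotient is infinite and the bound says that [E] is a null
event, which follows by letting [l] grow. *)
Lemma tail_le_gaussian (E : set T) (c t B : R) : measurable E ->
  0 < c -> 0 < t -> 0 <= B ->
  (0 < B -> (P E <= (expR (- (c * t ^+ 2 / B)))%:E)%E) ->
  (B = 0 -> forall l, 0 <= l -> (P E <= (expR (- (l * t)))%:E)%E) ->
  (P E <= expeR (- ((c * t ^+ 2)%:E / B%:E)))%E.
Proof.
move=> mE c0 t0 B0 Bpos Bnull; move: B0; rewrite le_eqVlt => /orP[/eqP B0|B0].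
  suff -> : P E = 0%E by exact: expeR_ge0.
  have PEfin : P E \is a fin_num by exact: fin_num_measure.
  rewrite -(fineK PEfin); congr EFin; apply/eqP; rewrite eq_le fine_ge0// andbT.
  rewrite leNgt; apply/negP => x0; set x := fine (P E) in x0.
  have l0 : 0 <= x^-1 / t by rewrite divr_ge0 ?invr_ge0 ?ltW.
  have := Bnull (esym B0) _ l0; rewrite -(fineK PEfin) lee_fin -/x divfK ?gt_eqF//.
  apply/negP; rewrite -ltNge expRN invf_plt ?posrE ?expR_gt0//.
  by apply: lt_le_trans (expR_ge1Dx _); rewrite ltrDr.
rewrite inver gt_eqF// -EFinM -EFinN /=; exact: Bpos.
Qed.

Variables (b c t : R).
Hypothesis b_ge0 : 0 <= b.
Hypothesis c_gt0 : 0 < c.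
Hypothesis c_le : c <= 1 / 8.
Hypothesis t_gt0 : 0 < t.

Lemma upper_tail :
  (forall l, 0 <= l -> l * b <= 1 / 4 ->
    exp_moment_bound P l (2 * l ^+ 2 * b * w) F) ->
  (P [set x | ('E_P[F] + t%:E <= (F x)%:E)%E] <=
   expeR (- ((c * t ^+ 2)%:E / (b * w)%:E)))%E.
Proof.
move=> bF; rewrite expectation_mean.
set E := [set x | _]; have EE : E = [set x | mean P F + t <= F x].
  by apply/seteqP; split => x; rewrite /E/= -EFinD lee_fin.
have mE : measurable E.
  rewrite EE -[X in measurable X]setTI.
  have -> : [set x | mean P F + t <= F x] = F @^-1` `[mean P F + t, +oo[%classic.
    by apply/seteqP; split => x /=; rewrite in_itv/= andbT.
  exact: mF.
(* [F] exceeds its mean by at most [w], so only [t <= w] remains; this keeps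
   [l b] below [1/4] for the minimiser [l = t / (4 b w)] of the exponent. *)
have [wt|tw] := ltP w t.
  suff -> : E = set0 by rewrite measure0 expeR_ge0.
  rewrite EE; apply/seteqP; split => // x /=; have /andP[_ Fw] := F_itv x.
  by have := mean_itv_ge0; lra.
have w0 : 0 < w by exact: lt_le_trans tw.
have PE l : 0 <= l -> l * b <= 1 / 4 ->
    (P E <= (expR (2 * l ^+ 2 * b * w - l * t))%:E)%E.
  move=> l0 lb; apply: (chernoff mE (bF _ l0 lb)) => x; rewrite EE/= => h.
  by rewrite -mulrDr ler_wpM2l.
apply: tail_le_gaussian => //; first by rewrite mulr_ge0// ltW.
  move=> bw; have b0 : 0 < b by move: bw; rewrite pmulr_lgt0.
  have l0 : 0 <= t / (4 * (b * w)) by rewrite divr_ge0 ?mulr_ge0 ?ltW.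
  have lb : t / (4 * (b * w)) * b <= 1 / 4.
    rewrite (_ : _ * b = t / (4 * w)); last by field; rewrite !gt_eqF.
    by rewrite ler_pdivrMr ?mulr_gt0//; lra.
  apply: (le_trans (PE _ l0 lb)); rewrite lee_fin ler_expR.
  rewrite (_ : _ - _ = - (1 / 8 * t ^+ 2 / (b * w))); last first.
    by field; rewrite !gt_eqF.
  by rewrite lerN2 ler_wpM2r ?invr_ge0 ?(ltW bw)// ler_wpM2r// sqr_ge0.
move=> bw0 l l0; have b0 : b = 0.
  by move/eqP : bw0; rewrite mulf_eq0 (gt_eqF w0) orbF => /eqP.
have lb : l * b <= 1 / 4 by rewrite b0 mulr0; lra.
by have := PE _ l0 lb; rewrite b0 mulr0 mul0r sub0r.
Qed.

Lemma lower_tail (v : R) : 0 <= v ->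
  (forall l, 0 <= l -> exp_moment_bound P (- l) (l ^+ 2 * v) F) ->
  (P [set x | ((F x)%:E <= 'E_P[F] - t%:E)%E] <=
   expeR (- ((c * t ^+ 2)%:E / v%:E)))%E.
Proof.
move=> v0 bF; rewrite expectation_mean.
set E := [set x | _]; have EE : E = [set x | F x <= mean P F - t].
  by apply/seteqP; split => x; rewrite /E/= -EFinB lee_fin.
have mE : measurable E.
  rewrite EE -[X in measurable X]setTI.
  have -> : [set x | F x <= mean P F - t] = F @^-1` `]-oo, mean P F - t]%classic.
    by apply/seteqP; split => x /=; rewrite in_itv.
  exact: mF.
have PE l : 0 <= l -> (P E <= (expR (l ^+ 2 * v - l * t))%:E)%E.
  move=> l0; apply: (chernoff mE (bF _ l0)) => x; rewrite EE/= => h.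
  by rewrite -lerN2 opprD !mulNr !opprK -mulrBr ler_wpM2l.
apply: tail_le_gaussian => //.
  (* The minimiser of [l^2 v - l t]. *)
  move=> {}v0; have l0 : 0 <= t / (2 * v) by rewrite divr_ge0 ?mulr_ge0 ?ltW.
  apply: (le_trans (PE _ l0)); rewrite lee_fin ler_expR.
  rewrite (_ : _ - _ = - (1 / 4 * t ^+ 2 / v)); last by field; rewrite gt_eqF.
  rewrite lerN2 ler_wpM2r ?invr_ge0 ?(ltW v0)// ler_wpM2r// ?sqr_ge0//.
  by apply: (le_trans c_le); lra.
by move=> v00 l l0; have := PE _ l0; rewrite v00 mulr0 sub0r.
Qed.

End tails.

Section constants.
Variable R : realType.
Let kappa : R := Num.sqrt (expR 1) / (2 * (Num.sqrt (expR 1) - 1)).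

(** Equivalent to [sqrt e <= 2]. *)
Lemma kappa_ge1 : 1 <= kappa.
Proof.
have s1 : 1 < Num.sqrt (expR 1) :> R.
  by rewrite -[ltLHS]sqrtr1 ltr_sqrt ?expR_gt0// expR_gt1.
have s2 : Num.sqrt (expR 1) <= 2 :> R.
  have : expR (1 / 2) <= 2 :> R.
    have := @expR_le_quadratic R (1 / 2); rewrite lexx andbT.
    have -> : 1 + 1 / 2 + 2 * (1 / 2) ^+ 2 = 2 :> R by field.
    by apply; lra.
  suff -> : Num.sqrt (expR 1) = expR (1 / 2) :> R by [].
  rewrite -[RHS]ger0_norm ?expR_ge0// -sqrtr_sqr expr2 -expRD.
  by congr (Num.sqrt (expR _)); field.
by rewrite /kappa ler_pdivlMr; lra.
Qed.

Lemma rate_itv : 0 < ln 2 / (8 * kappa) <= 1 / 8.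
Proof.
have k1 := kappa_ge1.
have l0 : 0 < ln 2 :> R by rewrite ln_gt0// ltr1n.
have l1 : ln 2 <= 1 :> R.
  rewrite -[leRHS]expRK ler_ln ?posrE ?expR_gt0//.
  by have := expR_ge1Dx (1 : R); lra.
apply/andP; split; first by rewrite divr_gt0//; lra.
by rewrite ler_pdivrMr; lra.
Qed.

End constants.

(** * Lebesgue measure on column vectors *)

Section lebesgue_boxes.
Variable R : realType.

Definition head_coords (m n : nat) (h : (m <= n)%N) (y : 'cV[R]_n) : 'cV[R]_m :=
  \col_i y (widen_ord h i) 0.

Lemma measurable_head_coords m n (h : (m <= n)%N) :
  measurable_fun setT (@head_coords m n h).
Proof.
apply: measurable_fun_mx => i j; under eq_fun do rewrite mxE.
exact: measurable_mx_entry.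
Qed.

Lemma lebesgueS m (A : set 'cV[R]_m.+1) :
  lebesgue R m.+1 A = ((lebesgue R m) \x (@lebesgue_measure R))%E (@snoc R m @^-1` A).
Proof. by []. Qed.

Lemma snoc_widen m (y : 'cV[R]_m * R) (i : 'I_m) :
  snoc y (widen_ord (leqnSn m) i) 0 = y.1 i 0.
Proof.
rewrite mxE; case: unliftP => [j /(congr1 val)/= ij|/(congr1 val)/= ij].
  by congr (y.1 _ _); apply: val_inj; move: ij; rewrite /= /bump leqNgt ltn_ord.
by have := ltn_ord i; rewrite ij ltnn.
Qed.

Lemma snoc_max m (y : 'cV[R]_m * R) : snoc y ord_max 0 = y.2.
Proof. by rewrite mxE unlift_none. Qed.

Variables a b : nat -> R.
Hypothesis ab : forall i, a i <= b i.

Definition head_box (m n : nat) (h : (m <= n)%N) (B : set 'cV[R]_m) :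
    set 'cV[R]_n :=
  [set y | B (head_coords h y) /\
    forall i : 'I_n, (m <= i)%N -> a i <= y i 0 <= b i].

Lemma measurable_head_box m n (h : (m <= n)%N) B : measurable B ->
  measurable (head_box h B).
Proof.
move=> mB; rewrite (_ : head_box h B = head_coords h @^-1` B `&`
    \bigcap_(i : 'I_n) [set y : 'cV[R]_n | (m <= i)%N -> a i <= y i 0 <= b i]).
  2: by apply/seteqP; split => [y [By yi]|y [By yi]]; split => // i;
    [move=> _; exact: yi|exact: (yi i I)].
apply: measurableI.
  by rewrite -[X in measurable X]setTI; exact: measurable_head_coords.
apply: fin_bigcap_measurable => // i _.
have [mi|mi] := leqP m i; last first.
  by rewrite (_ : [set y | _] = setT)//; apply/seteqP; split.
rewrite (_ : [set y | _] = (fun y : 'cV[R]_n => y i 0) @^-1` `[a i, b i]%classic).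
  by rewrite -[X in measurable X]setTI; exact: measurable_mx_entry.
by apply/seteqP; split => y /=; rewrite in_itv /=; [exact|move=> ? _].
Qed.

Lemma lebesgue_head_box m n (h : (m <= n)%N) B : measurable B ->
  lebesgue R n (head_box h B) =
  (lebesgue R m B * (\prod_(m <= i < n) (b i - a i))%:E)%E.
Proof.
elim: n h B => [|n IH] h B mB.
  have m0 : m = 0%N by apply/eqP; rewrite -leqn0.
  subst m.
  rewrite big_geq// mule1; congr (lebesgue R 0 _); apply/seteqP.
  have hE y : head_coords h y = y by apply/colP => -[].
  by split => y /=; rewrite /head_box/= hE; [case|split => // -[]].
have [mn|nm] := leqP m n; last first.
  have mE : m = n.+1 by apply/eqP; rewrite eqn_leq h nm.
  subst m; rewrite big_geq// mule1; congr (lebesgue R _ _); apply/seteqP.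
  have hE y : head_coords h y = y.
    by apply/colP => i; rewrite mxE; congr (y _ _); exact: val_inj.
  split => y /=; rewrite /head_box/= hE; [by case|split => // i].
  by rewrite leqNgt ltn_ord.
rewrite lebesgueS (_ : _ @^-1` _ = head_box mn B `*` `[a n, b n]%classic).
  rewrite product_measure1E//; last exact: measurable_head_box.
  have E : lebesgue_measure (`[a n, b n]%classic : set R) = (b n - a n)%:E.
    rewrite lebesgue_measure_itv/= lte_fin.
    have := ab n; rewrite le_eqVlt => /orP[/eqP ->|->]; last by rewrite EFinB.
    by rewrite ltxx subrr.
  by rewrite [X in (_ * X = _)%E]E IH// big_nat_recr//= EFinM muleA.
have hE y : head_coords h (snoc y) = head_coords mn y.1.
  apply/colP => i; rewrite [LHS]mxE [RHS]mxE -snoc_widen.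
  by congr (snoc y _ _); exact: val_inj.
apply/seteqP; split => -[y r]; rewrite /head_box /= in_itv/= hE.
  move=> [By yi]; split; last by have := yi ord_max mn; rewrite snoc_max.
  by split => // i mi; have := yi (widen_ord (leqnSn n) i) mi; rewrite snoc_widen.
move=> [[By yi] rn]; split => // i mi.
case: (unliftP ord_max i) => [j ij|->]; last by rewrite snoc_max.
have -> : i = widen_ord (leqnSn n) j.
  by apply: val_inj; rewrite ij /= /bump leqNgt ltn_ord.
by rewrite snoc_widen; apply: yi; move: mi; rewrite ij /= /bump (leqNgt n) ltn_ord.
Qed.

End lebesgue_boxes.

Section lebesgue_invariance.
Variable R : realType.

Lemma lebesgue_box m (r : R) : 0 <= r ->
  lebesgue R m [set y | forall i, - r <= y i 0 <= r] = ((2 * r) ^+ m)%:E.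
Proof.
move=> r0; have nr (i : nat) : (fun=> - r) i <= (fun=> r) i by rewrite ge0_cp.
have := @lebesgue_head_box R (fun=> - r) (fun=> r) nr 0 m (leq0n m) setT measurableT.
rewrite (_ : head_box _ _ _ _ = [set y | forall i, - r <= y i 0 <= r]); last first.
  by apply/seteqP; split => y /=; rewrite /head_box/=; [move=> [_ yi] i; exact: yi|].
move=> ->; rewrite /= diracE in_setT mul1e prodr_const_nat subn0.
by congr (_ ^+ _)%:E; ring.
Qed.

Lemma measurable_box m (r : R) :
  measurable [set y : 'cV[R]_m | forall i, - r <= y i 0 <= r].
Proof.
have := @measurable_head_box R (fun=> - r) (fun=> r) 0 m (leq0n m) setT measurableT.
congr measurable; apply/seteqP.
by split => y /=; rewrite /head_box/=; [move=> [_ yi] i; exact: yi|].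
Qed.

Lemma lebesgue_sigma_finite m : sigma_finite setT (lebesgue R m).
Proof.
exists (fun n => [set y : 'cV[R]_m | forall i, - n%:R <= y i 0 <= n%:R]).
  apply/seteqP; split => // y _.
  exists (Num.truncn (\sum_i `|y i 0|)).+1 => // i; rewrite -ler_norml.
  apply: le_trans (ltW (truncnS_gt _)).
  by rewrite (bigD1 i)//= lerDl sumr_ge0.
by move=> n; split; [exact: measurable_box|rewrite lebesgue_box// ltry].
Qed.

(** The function underlying [lebesgue], named so as to carry sigma-finiteness. *)
Definition leb m : set 'cV[R]_m -> \bar R := lebesgue R m.
Arguments leb : clear implicits.

HB.instance Definition _ m := isMeasure.Build _ _ _ (leb m)
  (measure0 (lebesgue R m)) (measure_ge0 (lebesgue R m))
  (@measure_semi_sigma_additive _ _ _ (lebesgue R m)).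

HB.instance Definition _ m := Measure_isSigmaFinite.Build _ _ _ (leb m)
  (lebesgue_sigma_finite m).

Lemma measurable_mxD m n d (T : measurableType d) (f g : T -> 'M[R]_(m, n)) :
  measurable_fun setT f -> measurable_fun setT g ->
  measurable_fun setT (fun t => f t + g t).
Proof.
move=> mf mg; apply: measurable_fun_mx => i j; under eq_fun do rewrite mxE.
by apply: measurable_funD; apply: measurableT_comp (measurable_mx_entry i j) _.
Qed.

Lemma measurable_mxN m n d (T : measurableType d) (f : T -> 'M[R]_(m, n)) :
  measurable_fun setT f -> measurable_fun setT (fun t => - f t).
Proof.
move=> mf; apply: measurable_fun_mx => i j; under eq_fun do rewrite mxE.
by apply: measurable_funN; apply: measurableT_comp (measurable_mx_entry i j) _.
Qed.

Lemma measurable_mxM m n p d (T : measurableType d) (f : T -> 'M[R]_(m, n))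
    (g : T -> 'M[R]_(n, p)) :
  measurable_fun setT f -> measurable_fun setT g ->
  measurable_fun setT (fun t => f t *m g t).
Proof.
move=> mf mg; apply: measurable_fun_mx => i j; under eq_fun do rewrite mxE.
apply: measurable_sum => k; apply: measurable_funM.
  exact: measurableT_comp (measurable_mx_entry i k) _.
exact: measurableT_comp (measurable_mx_entry k j) _.
Qed.

Lemma lebesgue_measure_shift (r : R) (A : set R) : measurable A ->
  lebesgue_measure [set x | A (x + r)] = lebesgue_measure A.
Proof.
move=> mA; have mf : measurable_fun setT (fun x : measurableTypeR R => (x + r : measurableTypeR R)).
  by apply: measurable_funD => //; exact: measurable_id.
pose nu := measure_function_pushforward__canonical__measure_function_Measure
  (@lebesgue_measure R) mf.
have nuE X : ocitv X -> lebesgue_measure X = nu X.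
  move=> [[x y] _ <-]; rewrite /nu/= /pushforward.
  rewrite (_ : _ @^-1` _ = `]x - r, y - r]%classic); last first.
    by apply/seteqP; split => z /=; rewrite !in_itv/= lerBrDr ltrBlDr.
  rewrite !lebesgue_measure_itv/= !lte_fin ltrD2r -!EFinB.
  by congr (if _ then _ else _); congr EFin; ring.
exact/esym/(lebesgue_measure_unique nuE).
Qed.

Lemma leb_shift m (x : 'cV[R]_m) A : measurable A ->
  leb m [set y | A (y + x)] = leb m A.
Proof.
elim: m x A => [|m IH] x A mA.
  by congr (leb 0); apply/seteqP; split => y /=; rewrite (flatmx0 x) addr0.
pose x1 := head_coords (leqnSn m) x; pose x2 := x ord_max 0.
pose f (p : 'cV[R]_m * measurableTypeR R) : 'cV[R]_m * measurableTypeR R := (p.1 + x1, p.2 + x2).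
have mf : measurable_fun setT f.
  apply/measurable_fun_pairP; split => /=.
    by apply: measurable_mxD => //; exact: measurable_fst.
  by apply: measurable_funD => //; exact: measurable_snd.
pose S := @snoc R m @^-1` A.
have mS : measurable S by rewrite -[S]setTI; exact: measurable_snoc.
rewrite /leb !lebesgueS.
rewrite (_ : _ @^-1` [set y | A (y + x)] = f @^-1` S); last first.
  apply/seteqP.
  have E p : snoc p + x = snoc (f p).
    apply/colP => i; rewrite !mxE; case: unliftP => [j ->|->//] /=.
    rewrite !mxE; congr (_ + x _ _); apply: val_inj.
    by rewrite /= /bump leqNgt ltn_ord.
  by split => p /=; rewrite /S/= E.
apply/esym; rewrite -[RHS]/(pushforward ((leb m) \x lebesgue_measure)%E f S).
apply: (@product_measure_unique _ _ _ _ _ (leb m) lebesgue_measure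
  (measure_function_pushforward__canonical__measure_function_Measure
     ((leb m) \x lebesgue_measure)%E mf)) => // A1 A2 mA1 mA2 /=.
rewrite /pushforward (_ : f @^-1` _ = [set y | A1 (y + x1)] `*` [set r | A2 (r + x2)]).
  rewrite product_measure1E//.
  - congr (_ * _)%E; [exact: IH|exact: lebesgue_measure_shift].
  - have m1 : measurable_fun setT (fun y : 'cV[R]_m => y + x1).
      by apply: measurable_mxD => //; exact: measurable_id.
    by have := m1 measurableT _ mA1; rewrite setTI.
  - have m2 : measurable_fun setT (fun y : measurableTypeR R => y + x2).
      by apply: measurable_funD => //; exact: measurable_id.
    by have := m2 measurableT _ mA2; rewrite setTI.
by apply/seteqP; split => -[].
Qed.

End lebesgue_invariance.

Arguments leb : clear implicits.

Section leb_orthogonal.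
Variable R : realType.
Local Notation leb := (leb R).

Lemma measurable_mulmx m n (M : 'M[R]_(m, n)) :
  measurable_fun setT (fun x : 'cV[R]_n => M *m x).
Proof. by apply: measurable_mxM => //; exact: measurable_id. Qed.

(** Both sides are the measure of the pairs [(x, y)] with [A (M x + y)] and
[B y]: translate [x] by [M^T y] on the left, and [y] by [M x] on the right. *)
Lemma leb_orthogonal_swap m (M : 'M[R]_m) (A B : set 'cV[R]_m) :
  M *m M^T = 1%:M -> measurable A -> measurable B ->
  (leb m [set x | A (M *m x)] * leb m B
   = leb m A * leb m [set x | B (- (M *m x))%R])%E.
Proof.
move=> MM mA mB.
pose E := [set p : 'cV[R]_m * 'cV[R]_m | A (M *m p.1 + p.2) /\ B p.2].
pose E' := [set p : 'cV[R]_m * 'cV[R]_m | A p.2 /\ B (p.2 - M *m p.1)].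
have mM1 : measurable_fun setT (fun p : 'cV[R]_m * 'cV[R]_m => M *m p.1).
  by exact: (measurableT_comp (measurable_mulmx M) measurable_fst).
have pre (f : 'cV[R]_m * 'cV[R]_m -> 'cV[R]_m) (S : set 'cV[R]_m) :
    measurable_fun setT f -> measurable S -> measurable [set p | S (f p)].
  by move=> mf mS; have := mf measurableT _ mS; rewrite setTI.
have mE : measurable E.
  apply: measurableI; last exact: (pre snd B measurable_snd mB).
  apply: (pre (fun p => M *m p.1 + p.2) A _ mA).
  by apply: measurable_mxD => //; exact: measurable_snd.
have mE' : measurable E'.
  apply: measurableI; first exact: (pre snd A measurable_snd mA).
  apply: (pre (fun p => p.2 - M *m p.1) B _ mB).
  by apply: measurable_mxD; [exact: measurable_snd|exact: measurable_mxN].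
have mAM : measurable [set x | A (M *m x)].
  by have := measurable_mulmx M measurableT mA; rewrite setTI.
have mBM y : measurable [set x | B (y - M *m x)].
  have mf : measurable_fun setT (fun x : 'cV[R]_m => y - M *m x).
    by apply: measurable_mxD => //; apply: measurable_mxN; exact: measurable_mulmx.
  by have := mf measurableT _ mB; rewrite setTI.
have mBM0 : measurable [set x | B (- (M *m x))].
  by have := mBM 0; congr measurable; apply/seteqP; split => x /=; rewrite sub0r.
have MK y : M *m (M^T *m y) = y by rewrite mulmxA MM mul1mx.
transitivity (\int[leb m]_y (leb m (ysection E y)))%E.
  transitivity (\int[leb m]_y (leb m [set x | A (M *m x)] * (\1_B y)%:E))%E.
    rewrite ge0_integralZl//; first by rewrite integral_indic// setIT.
    by apply/measurable_EFinP; exact: measurable_indic.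
  apply: eq_integral => y _; rewrite indicE.
  case: (boolP (y \in B)) => [/set_mem By|/negP nBy].
    rewrite mule1 -(leb_shift (M^T *m y) mAM); congr (leb m _).
    apply/seteqP; split => x; rewrite /ysection/= mulmxDr MK.
      by move=> Axy; rewrite inE; split.
    by rewrite inE => -[].
  rewrite mule0 (_ : ysection E y = set0) ?measure0//.
  apply/seteqP; split => // x; rewrite /ysection/= inE => -[_ By].
  by apply: nBy; exact: mem_set.
transitivity (\int[leb m]_x (leb m (xsection E x)))%E.
  have := indic_fubini_tonelli (leb m) (leb m) mE.
  by rewrite indic_fubini_tonelli_FE// indic_fubini_tonelli_GE// => /esym.
transitivity (\int[leb m]_x (leb m (xsection E' x)))%E.
  apply: eq_integral => x _.
  rewrite -(leb_shift (- (M *m x)) (measurable_xsection x mE)); congr (leb m _).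
  apply/seteqP; split => y; by rewrite /xsection/= !inE /E/E'/= [M *m x + _]addrC subrK.
transitivity (\int[leb m]_y (leb m (ysection E' y)))%E.
  have := indic_fubini_tonelli (leb m) (leb m) mE'.
  by rewrite indic_fubini_tonelli_FE// indic_fubini_tonelli_GE.
transitivity (\int[leb m]_y (leb m [set x | B (- (M *m x))%R] * (\1_A y)%:E))%E.
  apply: eq_integral => y _; rewrite indicE.
  case: (boolP (y \in A)) => [/set_mem Ay|/negP nAy].
    rewrite mule1 (_ : ysection E' y = [set x | B (y - M *m x)]).
      rewrite -(leb_shift (M^T *m y) (mBM y)); congr (leb m _).
      apply/seteqP; split => x /=; rewrite mulmxDr MK opprD addrCA subrr addr0//.
    by apply/seteqP; split => x; rewrite /ysection/= inE; [case|split].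
  rewrite mule0 (_ : ysection E' y = set0) ?measure0//.
  apply/seteqP; split => // x; rewrite /ysection/= inE => -[Ay _].
  by apply: nAy; exact: mem_set.
rewrite ge0_integralZl//; first by rewrite integral_indic// setIT muleC.
by apply/measurable_EFinP; exact: measurable_indic.
Qed.

Lemma leb_reflect m (B : set 'cV[R]_m) : measurable B ->
  leb m [set x | B (- x)] = leb m B.
Proof.
move=> mB; pose A := [set y : 'cV[R]_m | forall i, - 1 <= y i 0 <= 1].
have mA : measurable A by exact: measurable_box.
have := @leb_orthogonal_swap m 1%:M A B _ mA mB.
rewrite trmx1 mul1mx => /(_ erefl).
have -> : [set x | A (1%:M *m x)] = A by apply/seteqP; split => x /=; rewrite mul1mx.
have -> : [set x | B (- (1%:M *m x))] = [set x | B (- x)].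
  by apply/seteqP; split => x /=; rewrite mul1mx.
have -> : leb m A = ((2 * 1) ^+ m)%:E by exact: lebesgue_box.
set r := (_ ^+ m)%R; have r0 : 0 < r by rewrite exprn_gt0// mulr1.
move=> /(congr1 (fun x => (r^-1)%:E * x)%E).
by rewrite !muleA -EFinM mulVf ?gt_eqF// !mul1e => ->.
Qed.

Lemma orthogonal_sum_sqr m (M : 'M[R]_m) (x : 'cV[R]_m) : M *m M^T = 1%:M ->
  \sum_i (M *m x) i 0 ^+ 2 = \sum_i x i 0 ^+ 2.
Proof.
move=> MM; have E (z : 'cV[R]_m) : \sum_i z i 0 ^+ 2 = (z^T *m z) 0 0.
  by rewrite mxE; apply: eq_bigr => i _; rewrite mxE expr2.
by rewrite !E trmx_mul -mulmxA [M^T *m _]mulmxA (mulmx1C MM) mul1mx.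
Qed.

(** By [leb_orthogonal_swap], a rotation multiplies volumes by a constant, which
is [1] for the Euclidean ball. *)
Lemma leb_orthogonal m (M : 'M[R]_m) (A : set 'cV[R]_m) :
  M *m M^T = 1%:M -> measurable A -> leb m [set x | A (M *m x)] = leb m A.
Proof.
move=> MM mA; pose B := [set y : 'cV[R]_m | \sum_i y i 0 ^+ 2 <= 1].
have mB : measurable B.
  have mf : measurable_fun setT (fun y : 'cV[R]_m => \sum_i y i 0 ^+ 2).
    apply: measurable_sum => i; apply: measurable_funX.
    exact: measurable_mx_entry.
  have := mf measurableT `]-oo, 1]%classic (measurable_itv _); rewrite setTI.
  by congr measurable; apply/seteqP; split => y /=; rewrite in_itv.
have := leb_orthogonal_swap MM mA mB.
have BE (x : 'cV[R]_m) : \sum_i (- (M *m x)) i 0 ^+ 2 = \sum_i x i 0 ^+ 2.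
  rewrite -mulmxN orthogonal_sum_sqr//.
  by apply: eq_bigr => i _; rewrite mxE sqrrN.
have -> : [set x | B (- (M *m x))] = B.
  by apply/seteqP; split => x; rewrite /B/= BE.
have Blt : (leb m B < +oo)%E.
  apply: (@le_lt_trans _ _ (leb m [set y | forall i, - 1 <= y i 0 <= 1])).
    apply: le_measure; rewrite ?inE//; first exact: measurable_box.
    move=> y /= By i; rewrite -ler_norml -(@expr_le1 _ 2)// real_normK ?num_real//.
    by apply: le_trans By; rewrite (bigD1 i)//= lerDl sumr_ge0// => j _; exact: sqr_ge0.
  by rewrite /leb lebesgue_box// ltry.
have Bgt : (0 < leb m B)%E.
  pose r : R := m.+1%:R^-1; have r0 : 0 < r by rewrite invr_gt0 ltr0n.
  apply: (@lt_le_trans _ _ (leb m [set y | forall i, - r <= y i 0 <= r])).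
    by rewrite /leb lebesgue_box ?ltW// lte_fin exprn_gt0// mulr_gt0.
  apply: le_measure; rewrite ?inE//; first exact: measurable_box.
  move=> y /= yr; apply: (@le_trans _ _ (\sum_(i < m) r ^+ 2)).
    apply: ler_sum => i _; rewrite -real_normK ?num_real//.
    apply: lerXn2r; rewrite ?nnegrE ?normr_ge0 ?(ltW r0)// ler_norml; exact: yr.
  rewrite sumr_const card_ord -mulr_natl /r expr2 mulrA.
  have m1 : m%:R / m.+1%:R <= 1 :> R by rewrite ler_pdivrMr ?ltr0n// mul1r ler_nat.
  by rewrite mulr_ile1// ?divr_ge0 ?invr_ge0// invf_le1 ?ltr0n// ler1n.
have [r BrE] : exists r, leb m B = r%:E.
  by exists (fine (leb m B)); rewrite fineK// ge0_fin_numE.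
rewrite BrE in Bgt *; rewrite lte_fin in Bgt.
move=> /(congr1 (fun x => x * (r^-1)%:E)%E).
by rewrite -!muleA -EFinM mulfV ?gt_eqF// !mule1.
Qed.

End leb_orthogonal.

(** * Boxes, compact sets and the Hausdorff sigma-algebra *)

Section rational_boxes.
Context {R : realType} {m n : nat}.

Definition rational_box (k : nat) : set 'M[R]_(m, n) :=
  if (unpickle k : option ('M[rat]_(m, n) * nat)) is Some q then
    [set M | forall i j, `|ratr (q.1 i j) - M i j| < q.2.+1%:R^-1]
  else set0.

Lemma open_rational_box k : open (rational_box k).
Proof.
rewrite /rational_box; case: unpickle => [q|]; last exact: open0.
suff near_box (M : 'M[R]_(m, n)) :
    (forall i j, `|ratr (q.1 i j) - M i j| < q.2.+1%:R^-1) ->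
    nbhs M [set M' : 'M[R]_(m, n) | forall i j, `|ratr (q.1 i j) - M' i j| < q.2.+1%:R^-1].
  by rewrite openE => M Mq; exact: near_box.
move=> Mq.
pose f i j := [set M' : 'M[R]_(m, n) | `|ratr (q.1 i j) - M' i j| < q.2.+1%:R^-1].
apply: (@filter_forall _ _ (fun i => [set M' | forall j, f i j M']) (nbhs M)) => i.
apply: (@filter_forall _ _ (f i) (nbhs M)) => j.
apply: open_nbhs_nbhs; split; last exact: Mq.
have -> : f i j = (fun M' : 'M[R]_(m, n) => M' i j) @^-1`
    `]ratr (q.1 i j) - q.2.+1%:R^-1, ratr (q.1 i j) + q.2.+1%:R^-1[%classic.
  by apply/seteqP; split => M' /=; rewrite in_itv/= -ltr_distlC.
apply: open_comp; last exact: interval_open.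
by move=> M' _; exact: coord_continuous.
Qed.

Lemma measurable_rational_box k : measurable (rational_box k).
Proof. by apply: sub_sigma_algebra; exact: open_rational_box. Qed.

Lemma rational_box_basis (U : set 'M[R]_(m, n)) M : open U -> U M ->
  exists2 k, rational_box k M & rational_box k `<=` U.
Proof.
move=> oU UM; have /nbhs_ballP[e /= e0 eU] : nbhs M U by exact: open_nbhs_nbhs.
pose N := Num.truncn (2 / e).
have Ne : 2 * N.+1%:R^-1 < e.
  by rewrite ltr_pdivrMr ?ltr0n// -ltr_pdivrMl// mulrC truncnS_gt.
have N0 : 0 < N.+1%:R^-1 :> R by rewrite invr_gt0 ltr0n.
have approx i j : exists q : rat, `|ratr q - M i j| < N.+1%:R^-1.
  have : M i j - N.+1%:R^-1 < M i j + N.+1%:R^-1 by rewrite ltrD2l gt0_cp.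
  move=> /rat_in_itvoo[q]; rewrite in_itv/= => q_itv; exists q.
  by rewrite ltr_distl.
pose q i j := sval (cid (approx i j)).
have qP i j : `|ratr (q i j) - M i j| < N.+1%:R^-1 by exact: (svalP (cid (approx i j))).
exists (pickle (\matrix_(i, j) q i j, N)); rewrite /rational_box pickleK /=.
  by move=> i j; rewrite mxE.
move=> M' M'q; apply: eU; split=> // i j; apply: le_lt_trans Ne.
rewrite mulr2n mulrDl mul1r /= -(subrKA (ratr (q i j))).
apply: (le_trans (ler_normD _ _)); rewrite lerD//; apply: ltW; first by rewrite distrC.
by have := M'q i j; rewrite mxE.
Qed.

Lemma rational_box_generates : @measurable _ 'M[R]_(m, n) `<=` <<s range rational_box>>.
Proof.
apply: smallest_sub; first exact: smallest_sigma_algebra.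
move=> U oU; have -> : U = \bigcup_k (if `[< rational_box k `<=` U >] then rational_box k else set0).
  apply/seteqP; split => [M UM|M [k _]]; last by case: asboolP => // kU /kU.
  have [k kM kU] := rational_box_basis oU UM.
  by exists k => //; rewrite ifT//; exact/asboolP.
apply: sigma_algebra_bigcup => k; case: ifP => _; last exact: sigma_algebra0.
by apply: sub_sigma_algebra; exists k.
Qed.

Lemma rational_box_separates (M N : 'M[R]_(m, n)) :
  (forall k, rational_box k M <-> rational_box k N) -> M = N.
Proof.
move=> MN; apply: contrapT => /eqP neMN.
have oN : open (~` [set N]).
  by apply: closed_openC; apply: accessible_closed_set1; apply: hausdorff_accessible; exact: norm_hausdorff.
have [k kM kN] := @rational_box_basis _ M oN (elimN eqP neMN).
by have /kN := (MN k).1 kM; apply.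
Qed.

End rational_boxes.

Section euclidean_distance.
Context {R : realType} {m : nat}.
Implicit Types (x y : 'cV[R]_m) (K L W : set 'cV[R]_m).

Lemma enorm_ge0 x : 0 <= enorm x. Proof. exact: sqrtr_ge0. Qed.

Lemma coord_le_enorm x i : `|x i 0| <= enorm x.
Proof.
rewrite -sqrtr_sqr ler_sqrt ?sumr_ge0// => [|j _]; last exact: sqr_ge0.
by rewrite (bigD1 i)//= lerDl sumr_ge0// => j _; exact: sqr_ge0.
Qed.

Lemma enorm_le_coord x (r : R) : 0 <= r -> (forall i, `|x i 0| <= r) ->
  enorm x <= m.+1%:R * r.
Proof.
move=> r0 xr; have mr0 : 0 <= m.+1%:R * r by rewrite mulr_ge0.
rewrite -[leRHS]ger0_norm// -sqrtr_sqr ler_sqrt ?sqr_ge0//.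
apply: (@le_trans _ _ (\sum_(i < m) r ^+ 2)).
  apply: ler_sum => i _; rewrite -real_normK ?num_real//.
  by apply: lerXn2r; rewrite ?nnegrE.
rewrite sumr_const card_ord -[leLHS]mulr_natl exprMn ler_wpM2r ?sqr_ge0//.
by rewrite -natrX ler_nat -{1}[m]muln1 leq_mul.
Qed.

Lemma closed_compact K : compact K -> closed K.
Proof. by apply: compact_closed; exact: norm_hausdorff. Qed.

Lemma measurable_closed_mx K : closed K -> measurable K.
Proof.
move=> cK; rewrite -[K]setCK; apply: measurableC; apply: sub_sigma_algebra.
exact: closed_openC.
Qed.

Lemma compact_coord_bounded K : compact K ->
  exists2 r : R, 0 <= r & forall x, K x -> forall i, `|x i 0| <= r.
Proof.
move=> cK.
have coord i : exists r : R, forall x, K x -> `|x i 0| <= r.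
  have : bounded_set [set (x i 0 : R^o) | x in K].
    apply: compact_bounded; apply: continuous_compact => //.
    by apply: continuous_subspaceT => x; exact: coord_continuous.
  move=> [M [_ MP]]; exists (M + 1) => x Kx.
  by apply: (MP (M + 1)); [rewrite ltrDl|exists x].
pose r i := sval (cid (coord i)).
have rP i x : K x -> `|x i 0| <= r i by exact: (svalP (cid (coord i))).
exists (\sum_i `|r i|); first by rewrite sumr_ge0.
move=> x Kx i; apply: le_trans (rP i x Kx) _; rewrite (bigD1 i)//=.
by apply: le_trans (ler_norm _) _; rewrite lerDl sumr_ge0.
Qed.

Lemma enorm_sub_bounded K L : compact K -> compact L ->
  exists r : R, forall x y, K x -> L y -> enorm (x - y) <= r.
Proof.
move=> /compact_coord_bounded[r r0 rP] /compact_coord_bounded[s s0 sP].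
exists (m.+1%:R * (r + s)) => x y Kx Ly.
apply: enorm_le_coord; first exact: addr_ge0.
move=> i; rewrite !mxE (le_trans (ler_normB _ _))// lerD//; [exact: rP|exact: sP].
Qed.

Lemma enorm_le_diam W x y : compact W -> W x -> W y -> enorm (x - y) <= diam W.
Proof.
move=> cW Wx Wy; apply: ub_le_sup; last by exists (x, y).
have [r rP] := enorm_sub_bounded cW cW.
by exists r => _ [[x' y'] /= [Wx' Wy'] <-]; exact: rP.
Qed.

Lemma diam_ge0 W : compact W -> W !=set0 -> 0 <= diam W.
Proof. by move=> cW [x Wx]; apply: le_trans (enorm_ge0 (x - x)) (enorm_le_diam cW Wx Wx). Qed.

Lemma hausdorff_dist_near (K L : ncompact R m) x (e : R) : ncompact_set K x ->
  hausdorff_dist K L < e -> exists2 y, ncompact_set L y & enorm (x - y) < e.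
Proof.
move=> Kx; rewrite /hausdorff_dist gt_max => /andP[KLe _].
have [y0 Ly0] := ncompact_neq0 L.
have dist_lb z : has_lbound [set enorm (z - y) | y in ncompact_set L].
  by exists 0 => _ [y _ <-]; exact: enorm_ge0.
have : inf [set enorm (x - y) | y in ncompact_set L] < e.
  apply: le_lt_trans KLe; apply: ub_le_sup; last by exists x.
  have [r rP] := enorm_sub_bounded (@ncompactP _ _ K) (@ncompactP _ _ L).
  exists r => _ [z Kz <-]; apply: le_trans (rP z y0 Kz Ly0).
  by apply: ge_inf; [exact: dist_lb|exists y0].
move=> /inf_lt[|_ [y Ly <-] xye]; first by exists (enorm (x - y0)); exists y0.
by exists y.
Qed.

Definition hits (U : set 'cV[R]_m) : set (ncompact R m) :=
  [set K | exists2 x, ncompact_set K x & U x].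

Lemma measurable_hits U : open U -> measurable (hits U).
Proof.
move=> oU; apply: sub_sigma_algebra => K [x Kx Ux].
have /nbhs_ballP[e /= e0 eU] : nbhs x U by exact: open_nbhs_nbhs.
exists e => // L KLe; have [y Ly xye] := hausdorff_dist_near Kx KLe.
exists y => //; apply: eU; split => // i j; rewrite (ord1 j).
apply: le_lt_trans xye; have := coord_le_enorm (x - y) i.
by rewrite !mxE.
Qed.

(** A closed set is determined by the boxes that it hits; countably many such
events thus decide whether a random compact set contains a random point. *)
Lemma compact_memP (K : ncompact R m) z :
  ncompact_set K z <-> forall k, rational_box k z -> hits (rational_box k) K.
Proof.
split => [Kz k kz|H]; first by exists z.
apply: contrapT => nKz; have oK : open (~` ncompact_set K).
  by apply: closed_openC; apply: closed_compact; exact: ncompactP.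
have [k kz kK] := rational_box_basis oK nKz.
by have [x Kx /kK] := H k kz; apply.
Qed.

Lemma hits_separates (K L : ncompact R m) :
  (forall k, hits (rational_box k) K <-> hits (rational_box k) L) -> K = L.
Proof.
move=> KL; have E : ncompact_set K = ncompact_set L.
  apply/seteqP; split => z /compact_memP zP; apply/compact_memP => k /zP; by rewrite KL.
move: K L E {KL} => [K K0 cK] [L L0 cL] /= E; subst L.
by congr NCompact; exact: Prop_irrelevance.
Qed.

Lemma measurable_compact_mem :
  measurable [set p : 'cV[R]_m * ncompact R m | ncompact_set p.2 p.1].
Proof.
rewrite (_ : [set p | _] = \bigcap_k
    ((~` rational_box k) `*` setT `|` setT `*` hits (rational_box k))).
  apply: bigcapT_measurable => k; apply: measurableU; apply: measurableX => //.
    by apply: measurableC; exact: measurable_rational_box.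
  by apply: measurable_hits; exact: open_rational_box.
apply/seteqP; split => -[z K] /=.
  move=> /compact_memP Kz k _ /=; have [kz|nkz] := pselect (rational_box k z).
    by right; split => //; exact: Kz.
  by left.
by move=> H; apply/compact_memP => k kz; have [[]|[]] := H k I.
Qed.

End euclidean_distance.

(** * Cylinders *)

Section cylinders.
Context {R : realType} {d : nat} {k : 'I_d}.
Local Notation pr := (@head_coords R (d - k) d (leq_subr k d)).
Local Notation leb := (leb R).
Implicit Types (y v : 'cV[R]_d) (u x : 'cV[R]_(d - k)).

Lemma embed_head u i : embed u (widen_ord (leq_subr k d) i) 0 = u i 0.
Proof.
rewrite summxE (bigD1 i)//= !mxE eqxx mulr1 big1 ?addr0// => j ji.
by rewrite !mxE eqxx andbT -val_eqE/= eq_sym val_eqE (negbTE ji) mulr0.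
Qed.

Lemma embed_tail u (i : 'I_d) : (d - k <= i)%N -> embed u i 0 = 0.
Proof.
move=> di; rewrite summxE big1// => j _.
rewrite !mxE eqxx andbT -val_eqE/=; case: eqVneq => [ij|]; last by rewrite mulr0.
by move: (ltn_ord j); rewrite -ij ltnNge di.
Qed.

Lemma head_embed u : pr (embed u) = u.
Proof. by apply/colP => i; rewrite mxE embed_head. Qed.

Lemma head_coordsD y v : pr (y + v) = pr y + pr v.
Proof. by apply/colP => i; rewrite !mxE. Qed.

Lemma head_E v : v \in E_ R k -> pr v = 0.
Proof.
rewrite /E_; set s := [seq _ | _ <- _ & _] => vE.
apply/colP => i; rewrite !mxE (coord_span (X := in_tuple s) vE).
rewrite summxE big1// => l _.
have : s`_l \in s by rewrite mem_nth.
move=> /mapP[j]; rewrite mem_filter => /andP[dj _] sl.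
rewrite mxE [X in _ * X](_ : _ = 0) ?mulr0// sl mxE eqxx andbT -val_eqE/=.
by case: eqVneq => // ij; move: (ltn_ord i); rewrite ij ltnNge dj.
Qed.

Lemma sub_embed_head y : y - embed (pr y) \in E_ R k.
Proof.
have -> : y - embed (pr y) =
    \sum_(i < d | (d - k <= i)%N) y i 0 *: std_basis R i.
  apply/colP => l; rewrite summxE [in LHS]mxE [X in _ + X]mxE.
  have [dl|ld] := leqP (d - k) l.
    rewrite embed_tail// subr0 (bigD1 l)//= !mxE !eqxx mulr1 big1 ?addr0//.
    by move=> i /andP[_ il]; rewrite !mxE eqxx andbT eq_sym (negbTE il) mulr0.
  have -> : l = widen_ord (leq_subr k d) (Ordinal ld) by exact: val_inj.
  rewrite embed_head mxE subrr big1// => i di.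
  rewrite !mxE eqxx andbT -val_eqE/=; case: eqVneq => [li|]; last by rewrite mulr0.
  by move: ld; rewrite li ltnNge di.
apply: memv_suml => i di; apply: memvZ; apply: memv_span; apply/mapP.
by exists i; rewrite // mem_filter di mem_enum.
Qed.

(** The representative is a rotation in either case: a selected minimum lies in a
set of rotations, and the default value is the identity. *)
Lemma SOdk_orthogonal (M : SOdk R k) : M *m (SOdk_mx M)^T = 1%:M.
Proof.
have [L _ <-] := SOdkP M; rewrite /lex_min.
by case: xgetP => [N _ [[[-> _] _] _]//|_]; rewrite trmx1 mul1mx.
Qed.

(** In the frame rotated by [theta], the direction space of the cylinder is the
kernel of the projection to the head coordinates. *)
Lemma cylinderP (p : 'cV[R]_(d - k) * (SOdk R k * ncompact R (d - k))) y :
  cylinder p y <-> ncompact_set p.2.2 (pr ((SOdk_mx p.2.1)^T *m y) - p.1).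
Proof.
have MM := SOdk_orthogonal p.2.1.
split => [[z Kz [v /= vE <-]]|Ky].
  rewrite mulmxA (mulmx1C MM) mul1mx head_coordsD head_embed (head_E vE) addr0.
  by rewrite addrC addKr.
exists (pr ((SOdk_mx p.2.1)^T *m y) - p.1) => //.
exists ((SOdk_mx p.2.1)^T *m y - embed (pr ((SOdk_mx p.2.1)^T *m y))).
  exact: sub_embed_head.
by rewrite [p.1 + _]addrC subrK [embed _ + _]addrC subrK mulmxA MM mul1mx.
Qed.

Lemma measurable_SOdk_mx : measurable_fun setT (@SOdk_mx R d k).
Proof.
apply: (@measurability _ _ _ _ _ _ _ (erefl : @measurable _ 'M[R]_d = <<s open>>)).
move=> _ [U oU <-]; rewrite setTI; apply: sub_sigma_algebra.
by exists U => //; rewrite setTI.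
Qed.

Definition cylinder_graph :
    set (('cV[R]_(d - k) * (SOdk R k * ncompact R (d - k))) * 'cV[R]_d) :=
  [set q | cylinder q.1 q.2].

Lemma measurable_cylinder_graph : measurable cylinder_graph.
Proof.
pose f (q : ('cV[R]_(d - k) * (SOdk R k * ncompact R (d - k))) * 'cV[R]_d) :=
  (pr ((SOdk_mx q.1.2.1)^T *m q.2) - q.1.1, q.1.2.2).
pose X := ('cV[R]_(d - k) * (SOdk R k * ncompact R (d - k)))%type.
have m1 : measurable_fun setT (fun q : X * 'cV[R]_d => q.1) by exact: measurable_fst.
have m11 : measurable_fun setT (fun q : X * 'cV[R]_d => q.1.1).
  exact: (measurableT_comp measurable_fst m1).
have m12 : measurable_fun setT (fun q : X * 'cV[R]_d => q.1.2).
  exact: (measurableT_comp measurable_snd m1).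
have m121 : measurable_fun setT (fun q : X * 'cV[R]_d => SOdk_mx q.1.2.1).
  exact: (measurableT_comp measurable_SOdk_mx (measurableT_comp measurable_fst m12)).
have mf : measurable_fun setT f.
  apply/measurable_fun_pairP; split; last first.
    exact: (measurableT_comp measurable_snd m12).
  apply: measurable_mxD; last exact: measurable_mxN.
  apply: (measurableT_comp (measurable_head_coords (leq_subr k d))).
  apply: measurable_mxM; last exact: measurable_snd.
  apply: measurable_fun_mx => i j; under eq_fun do rewrite mxE.
  exact: (measurableT_comp (measurable_mx_entry j i) m121).
have := mf measurableT _ measurable_compact_mem; rewrite setTI.
congr measurable; apply/seteqP.
by split => q /=; [move=> H; apply/cylinderP|move=> /cylinderP].
Qed.

Lemma xsection_cylinder_graph p : xsection cylinder_graph p = cylinder p.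
Proof. by apply/seteqP; split => y; rewrite /xsection/= inE. Qed.

Lemma measurable_cylinder p : measurable (@cylinder R d k p).
Proof.
rewrite -xsection_cylinder_graph.
exact: (measurable_xsection p measurable_cylinder_graph).
Qed.

Lemma measurable_leb_ncompact m :
  measurable_fun setT (fun K : ncompact R m => leb m (ncompact_set K)).
Proof.
have := measurable_fun_ysection (leb m) (@measurable_compact_mem R m).
congr (measurable_fun setT); apply/funext => K /=; congr (leb m _).
by apply/seteqP; split => x; rewrite /ysection/= inE.
Qed.

(** In the rotated frame the cylinder is the product of its base with the last
[k] coordinate axes, along which [W] extends over at most its diameter. *)
Lemma leb_cylinderI_le p (W : set 'cV[R]_d) : compact W -> W !=set0 ->
  (leb d (cylinder p `&` W)
   <= leb (d - k) (ncompact_set p.2.2) * (diam W ^+ k)%:E)%E.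
Proof.
move=> cW W0; set M := SOdk_mx p.2.1.
have MM : M *m M^T = 1%:M := SOdk_orthogonal p.2.1.
have MM' : M^T *m M^T^T = 1%:M by rewrite trmxK; exact: mulmx1C.
have D0 := diam_ge0 cW W0.
have mW : measurable W by apply: measurable_closed_mx; exact: closed_compact.
have mCW : measurable (cylinder p `&` W).
  by apply: measurableI => //; exact: measurable_cylinder.
pose S (j : 'I_d) := [set (M^T *m y) j 0 | y in W].
pose a (i : nat) : R := if insub i is Some j then inf (S j) else 0.
have Sub (j : 'I_d) y y' : W y -> W y' -> (M^T *m y) j 0 - (M^T *m y') j 0 <= diam W.
  move=> Wy Wy'; apply: le_trans (enorm_le_diam cW Wy Wy').
  have -> : enorm (y - y') = enorm (M^T *m (y - y')).
    by rewrite /enorm orthogonal_sum_sqr.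
  rewrite mulmxBr; apply: le_trans (coord_le_enorm _ j).
  by rewrite !mxE ler_norm.
have [y0 Wy0] := W0.
have lbS j : has_lbound (S j).
  exists ((M^T *m y0) j 0 - diam W) => _ [y Wy <-].
  by rewrite lerBlDr -lerBlDl; exact: Sub.
have mB : measurable [set z | ncompact_set p.2.2 (z - p.1)].
  have mf : measurable_fun setT (fun z : 'cV[R]_(d - k) => z - p.1).
    by apply: measurable_mxD => //; exact: measurable_id.
  have mK : measurable (ncompact_set p.2.2).
    by apply: measurable_closed_mx; apply: closed_compact; exact: ncompactP.
  by have := mf measurableT _ mK; rewrite setTI.
rewrite -(leb_orthogonal MM mCW).
have aD i : a i <= (fun i => a i + diam W) i by rewrite lerDl.
apply: (@le_trans _ _ (leb d (head_box a (fun i => a i + diam W) (leq_subr k d)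
    [set z | ncompact_set p.2.2 (z - p.1)]))).
  apply: le_measure; rewrite ?inE.
  - by have := measurable_mulmx M measurableT mCW; rewrite setTI.
  - exact: measurable_head_box.
  move=> u /= [/cylinderP]; rewrite mulmxA (mulmx1C MM) mul1mx => Ku Wu.
  split => // i _; rewrite /a valK.
  have uE : u i 0 = (M^T *m (M *m u)) i 0 by rewrite mulmxA (mulmx1C MM) mul1mx.
  apply/andP; split; first by apply: ge_inf => //; exists (M *m u).
  rewrite -lerBlDr; apply: lb_le_inf; first by exists (u i 0); exists (M *m u).
  by move=> _ [y Wy <-]; rewrite lerBlDr -lerBlDl uE; exact: Sub.
rewrite /leb lebesgue_head_box//.
rewrite (eq_bigr (fun=> diam W)); last by move=> i _; rewrite addrC addKr.
rewrite prodr_const_nat subKn; last exact: ltnW.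
rewrite lee_wpmul2r ?lee_fin ?exprn_ge0//.
have mK : measurable (ncompact_set p.2.2).
  by apply: measurable_closed_mx; apply: closed_compact; exact: ncompactP.
by have := leb_shift (- p.1) mK; rewrite /leb => ->.
Qed.

End cylinders.

Section cylinder_process.
Context {R : realType} {d : nat} {k : 'I_d}.
Local Notation pr := (@head_coords R (d - k) d (leq_subr k d)).
Local Notation X := ('cV[R]_(d - k) * (SOdk R k * ncompact R (d - k)))%type.
Local Notation leb := (leb R).

Definition mark_family (i : nat + (nat + nat)) : set X :=
  match i with
  | inl n => [set p | rational_box n p.1]
  | inr (inl n) => [set p | rational_box n (SOdk_mx p.2.1)]
  | inr (inr n) => [set p | hits (rational_box n) p.2.2]
  end.

Definition separating (n : nat) : set X :=
  if unpickle n is Some i then mark_family i else set0.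

Lemma measurable_separating n : measurable (separating n).
Proof.
rewrite /separating; case: unpickle => // -[m|[m|m]] /=.
- have := @measurable_fst _ _ 'cV[R]_(d - k) (SOdk R k * ncompact R (d - k))%type
    measurableT _ (measurable_rational_box m).
  by rewrite setTI.
- have mf : measurable_fun setT (fun p : X => SOdk_mx p.2.1).
    exact: (measurableT_comp measurable_SOdk_mx
      (measurableT_comp measurable_fst measurable_snd)).
  by have := mf measurableT _ (measurable_rational_box m); rewrite setTI.
- have mf : measurable_fun setT (fun p : X => p.2.2).
    exact: (measurableT_comp measurable_snd measurable_snd).
  have := mf measurableT _ (measurable_hits (@open_rational_box R (d - k) 1 m)).
  by rewrite setTI.
Qed.

Lemma separatingP (p q : X) : (forall n, separating n p <-> separating n q) -> p = q.
Proof.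
move=> pq; have {}pq i : mark_family i p <-> mark_family i q.
  by have := pq (pickle i); rewrite /separating pickleK.
case: p q pq => [x [M K]] [y [N L]] pq.
have -> : x = y by apply: rational_box_separates => n; exact: (pq (inl n)).
have -> : K = L by apply: hits_separates => n; exact: (pq (inr (inr n))).
have MN : SOdk_mx M = SOdk_mx N.
  by apply: rational_box_separates => n; exact: (pq (inr (inl n))).
congr (_, (_, _)); move: M N MN {pq} => [M M1] [N N1] /= E; subst N.
by congr MkSOdk; exact: Prop_irrelevance.
Qed.

Variables (gamma : R) (gamma_gt0 : 0 < gamma).
Variable Q : probability (SOdk R k * ncompact R (d - k))%type R.
Variables (W : set 'cV[R]_d) (mW : measurable W) (Woo : (leb d W < +oo)%E).

Definition window_measure : {finite_measure set 'cV[R]_d -> \bar R} := mfrestr mW Woo.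
Local Notation mu := window_measure.

Definition intensity : {measure set X -> \bar R} :=
  mscale (NngNum (ltW gamma_gt0)) (leb (d - k) \x Q)%E.

Lemma mu_fin_section (p : X) : (vol mu (cylinder p))%:E = mu (cylinder p).
Proof. by rewrite volK//; exact: measurable_cylinder. Qed.

Lemma vol_windowT : vol mu setT = fine (leb d W).
Proof. by rewrite /vol/= /mfrestr /mrestr setTI. Qed.

Lemma measurable_cylinder_setY (D : set 'cV[R]_d) : measurable D ->
  measurable_fun setT (fun p : X => vol mu (cylinder p `+` D)).
Proof.
move=> mD; pose S := cylinder_graph `+` (setT `*` D) : set (X * 'cV[R]_d).
have mS : measurable S.
  by apply: measurable_setY; [exact: measurable_cylinder_graph|exact: measurableX].
have mxS : measurable_fun setT (fun p => mu (xsection S p)).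
  exact: measurable_fun_xsection.
have := measurableT_comp (fine_measurable measurableT) mxS.
congr (measurable_fun setT); apply/funext => p /=; congr (fine (mu _)).
apply/seteqP; split => y; rewrite /xsection/= inE /S/setY/setD/cylinder_graph/=.
  by move=> [[py nD]|[[_ Dy] npy]]; [left; split => // Dy; exact: nD|right].
by move=> [[py nD]|[Dy npy]]; [left; split => // -[_ Dy]; exact: nD|right].
Qed.

Variable A : R.
Hypothesis A_ge0 : 0 <= A.

Definition small_base : set X :=
  [set p | (leb (d - k) (ncompact_set p.2.2) <= A%:E)%E].

Lemma measurable_small_mark :
  measurable [set q : SOdk R k * ncompact R (d - k) |
    (leb (d - k) (ncompact_set q.2) <= A%:E)%E].
Proof.
have mf : measurable_fun setT (fun q : SOdk R k * ncompact R (d - k) =>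
    leb (d - k) (ncompact_set q.2)).
  exact: (measurableT_comp (@measurable_leb_ncompact R (d - k)) measurable_snd).
rewrite -[X in measurable X]setTI.
exact: (emeasurable_fun_infty_c measurableT mf).
Qed.

Lemma measurable_small_base : measurable small_base.
Proof.
have := @measurable_snd _ _ 'cV[R]_(d - k) (SOdk R k * ncompact R (d - k))%type
  measurableT _ measurable_small_mark.
by rewrite setTI.
Qed.

(** For a fixed mark, the cylinders covering [y] are those shifted by a point of
a reflected translate of the base. *)
Lemma mean_window_volume (q : SOdk R k * ncompact R (d - k)) :
  (\int[leb (d - k)]_x mu (cylinder (x, q))
   = leb (d - k) (ncompact_set q.2) * leb d W)%E.
Proof.
pose f (r : 'cV[R]_(d - k) * 'cV[R]_d) : X * 'cV[R]_d := ((r.1, q), r.2).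
have mf : measurable_fun setT f.
  apply/measurable_fun_pairP; split; last exact: measurable_snd.
  by apply/measurable_fun_pairP; split; [exact: measurable_fst|exact: measurable_cst].
have mH : measurable (f @^-1` cylinder_graph).
  by have := mf measurableT _ measurable_cylinder_graph; rewrite setTI.
have mK : measurable (ncompact_set q.2).
  by apply: measurable_closed_mx; apply: closed_compact; exact: ncompactP.
transitivity (\int[leb (d - k)]_x mu (xsection (f @^-1` cylinder_graph) x))%E.
  apply: eq_integral => x _; congr (mu _).
  by apply/seteqP; split => y; rewrite /xsection/= inE.
transitivity (\int[mu]_y leb (d - k) (ysection (f @^-1` cylinder_graph) y))%E.
  have := indic_fubini_tonelli (leb (d - k)) mu mH.
  by rewrite indic_fubini_tonelli_FE// indic_fubini_tonelli_GE.
transitivity (\int[mu]_y (cst (leb (d - k) (ncompact_set q.2)) y))%E.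
  apply: eq_integral => y _ /=; set u := pr ((SOdk_mx q.1)^T *m y).
  have mKu : measurable [set z | ncompact_set q.2 (z + u)].
    have mg : measurable_fun setT (fun z : 'cV[R]_(d - k) => z + u).
      by apply: measurable_mxD => //; exact: measurable_id.
    by have := mg measurableT _ mK; rewrite setTI.
  rewrite -(leb_shift u mK) -(leb_reflect mKu); congr (leb (d - k) _).
  apply/seteqP; split => x; rewrite /ysection/= inE /cylinder_graph/=.
    by move=> /cylinderP /=; rewrite addrC.
  by rewrite addrC => H; apply/cylinderP.
by rewrite integral_cst//= /mfrestr /mrestr setTI.
Qed.

Lemma intensity_mean_volume :
  (\int[intensity]_(p in small_base) (vol mu (cylinder p))%:E
   <= (gamma * A)%:E * leb d W)%E.
Proof.
under eq_integral do rewrite mu_fin_section.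
have mg : measurable_fun setT (fun p : X => mu (cylinder p)).
  have -> : (fun p : X => mu (cylinder p)) = mu \o xsection cylinder_graph.
    by apply/funext => p /=; rewrite xsection_cylinder_graph.
  exact: (measurable_fun_xsection mu measurable_cylinder_graph).
rewrite /intensity ge0_integral_mscale//=; last 2 first.
- exact: measurable_small_base.
- exact: measurable_funS mg.
rewrite EFinM -muleA lee_wpmul2l ?lee_fin ?(ltW gamma_gt0)//.
rewrite integral_mkcond.
set f := _ \_ _; have f0 p : (0 <= f p)%E.
  by rewrite /f patchE; case: ifP.
have mf : measurable_fun setT f.
  apply/(measurable_restrictT _ measurable_small_base).
  exact: measurable_funS mg.
rewrite fubini_tonelli1// /fubini_F fubini_tonelli//.
apply: (@le_trans _ _ (\int[Q]_q (cst (A%:E * leb d W) q))%E); last first.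
  rewrite integral_cst// [X in (_ * X)%E](_ : _ = 1%E) ?mule1//.
  exact: probability_setT.
apply: ge0_le_integral => //=.
- by move=> q _; apply: integral_ge0.
- exact: measurable_fun_fubini_tonelli_G.
move=> q _; have [qA|qA] := pselect (leb (d - k) (ncompact_set q.2) <= A%:E)%E.
  rewrite (eq_integral (fun x => mu (cylinder (x, q)))) => [|x _].
    by rewrite mean_window_volume lee_wpmul2r.
  by rewrite /f patchE mem_set.
rewrite (eq_integral (fun=> 0%E)) => [|x _].
  by rewrite integral0 mule_ge0// lee_fin.
by rewrite /f patchE memNset.
Qed.

Definition bounded_shift (m : nat) : set X :=
  [set p : X | forall i, - m%:R <= p.1 i 0 <= m%:R] `&` small_base.

Let box_shift m : [set p : X | forall i, - m%:R <= p.1 i 0 <= m%:R] =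
  [set x : 'cV[R]_(d - k) | forall i, - m%:R <= x i 0 <= m%:R] `*` setT.
Proof. by apply/seteqP; split => -[x q] //= []. Qed.

Lemma measurable_bounded_shift m : measurable (bounded_shift m).
Proof.
apply: measurableI; last exact: measurable_small_base.
by rewrite box_shift; apply: measurableX => //; exact: measurable_box.
Qed.

Lemma bounded_shift_nd m n : (m <= n)%N -> bounded_shift m `<=` bounded_shift n.
Proof.
move=> mn p [pm pA]; split => // i; have /andP[p1 p2] := pm i.
have mnR : m%:R <= n%:R :> R by rewrite ler_nat.
by apply/andP; split; lra.
Qed.

Lemma bigcup_bounded_shift : \bigcup_m bounded_shift m = small_base.
Proof.
apply/seteqP; split => [p [m _ []]//|p pA].
exists (Num.truncn (\sum_i `|p.1 i 0|)).+1 => //; split => // i.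
rewrite -ler_norml; apply: le_trans (ltW (truncnS_gt _)).
by rewrite (bigD1 i)//= lerDl sumr_ge0.
Qed.

Lemma intensity_bounded_shift m : (intensity (bounded_shift m) < +oo)%E.
Proof.
have mb : measurable [set x : 'cV[R]_(d - k) | forall i, - m%:R <= x i 0 <= m%:R].
  exact: measurable_box.
apply: (@le_lt_trans _ _ (intensity
    ([set x : 'cV[R]_(d - k) | forall i, - m%:R <= x i 0 <= m%:R] `*` setT))).
  apply: le_measure; rewrite ?inE.
  - exact: measurable_bounded_shift.
  - exact: measurableX.
  by rewrite -box_shift; exact: subIsetl.
rewrite /intensity/= /mscale/= product_measure1E//= [X in (_ * (_ * X))%E](_ : _ = 1%E).
  by rewrite mule1 [X in (_ * X)%E](@lebesgue_box R (d - k) m%:R)// ltry.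
exact: probability_setT.
Qed.

End cylinder_process.

(** * The concentration inequality *)

Section typical_base.
Context {R : realType} {d : nat} {k : 'I_d}.
Variable Q : probability (SOdk R k * ncompact R (d - k))%type R.
Context {dX : measure_display} {T : measurableType dX}.
Variables (PX : probability T R) (Xi : T -> ncompact R (d - k)) (A : R).
Hypothesis Xi_typical : typical_cylinder_base PX Q Xi.
Hypothesis Xi_le : {ae PX, forall w, (leb R (d - k) (ncompact_set (Xi w)) <= A%:E)%E}.

Lemma volume_bound_ge0 : 0 <= A.
Proof.
have PT : (0 < PX setT)%E by rewrite probability_setT lte01.
have [w wA] := @filter_ex _ _ (ae_properfilter_algebraOfSetsType PT) _ Xi_le.
by rewrite -lee_fin (le_trans _ wA).
Qed.

Lemma mark_volume_le :
  Q [set q | ~ (leb R (d - k) (ncompact_set q.2) <= A%:E)%E] = 0%E.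
Proof.
have [mXi XiQ] := Xi_typical.
pose B := [set K : ncompact R (d - k) | ~ (leb R (d - k) (ncompact_set K) <= A%:E)%E].
have mB : measurable B.
  rewrite (_ : B = ~` [set K | (leb R (d - k) (ncompact_set K) <= A%:E)%E]) //.
  have mf := @measurable_leb_ncompact R (d - k).
  apply: measurableC; rewrite -[X in measurable X]setTI.
  exact: (emeasurable_fun_infty_c measurableT mf).
have <- : PX (Xi @^-1` B) =
    Q [set q | ~ (leb R (d - k) (ncompact_set q.2) <= A%:E)%E] by exact: XiQ.
have mXB : measurable (Xi @^-1` B).
  by have := mXi measurableT _ mB; rewrite setTI.
exact: measure_negligible mXB Xi_le.
Qed.

End typical_base.

Unset Implicit Arguments.

Theorem proposition5p3 (R : realType) (d : nat) (k : 'I_d)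
    (gamma : R) (gamma_gt0 : 0 < gamma)
    (Q : probability (SOdk R k * ncompact R (d - k))%type R)
    (dO : measure_display) (Omega : measurableType dO) (P : probability Omega R)
    (eta : Omega -> {measure set ('cV[R]_(d - k) *
                                  (SOdk R k * ncompact R (d - k))) -> \bar R})
    (eta_poisson : poisson_process P (cylinder_intensity gamma Q) eta)
    (dX : measure_display) (OmegaX : measurableType dX)
    (PX : probability OmegaX R) (Xi : OmegaX -> ncompact R (d - k))
    (Xi_typical : typical_cylinder_base PX Q Xi)
    (A : R) (Xi_le : {ae PX, forall w, (lebesgue R (d - k) (Xi w) <= A%:E)%E})
    (W : set 'cV[R]_d) (W_neq0 : W !=set0) (W_compact : compact W) :
  let Z := cylinder_union eta in
  let F := fun w => fine (lebesgue R d (Z w `&` W)) in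
  let kappa : R := Num.sqrt (expR 1) / (2 * (Num.sqrt (expR 1) - 1)) in
  let c : R := ln 2 / (8 * kappa) in
  forall t : R, 4 * Num.sqrt kappa <= t ->
  (P [set w | 'E_P[F] + t%:E <= (F w)%:E] <=
    expeR (- ((c * t ^+ 2)%:E /
              ((A * diam W ^+ k)%:E * lebesgue R d W))))%E /\
  (P [set w | (F w)%:E <= 'E_P[F] - t%:E] <=
    expeR (- ((c * t ^+ 2)%:E /
              ((gamma * A ^+ 2 * diam W ^+ k)%:E * lebesgue R d W))))%E.
Proof.
move=> Z F kappa c t tk.
have t0 : 0 < t.
  apply: lt_le_trans tk; rewrite mulr_gt0// sqrtr_gt0.
  by apply: lt_le_trans (kappa_ge1 R).
have /andP[c0 c1] : 0 < c <= 1 / 8 by exact: rate_itv.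
have mW : measurable W by apply: measurable_closed_mx; exact: closed_compact.
have A0 : 0 <= A := volume_bound_ge0 Xi_le.
have Woo : (leb R d W < +oo)%E.
  have [r r0 rP] := compact_coord_bounded W_compact.
  apply: (@le_lt_trans _ _ (leb R d [set y | forall i, - r <= y i 0 <= r])).
    apply: le_measure; rewrite ?inE//; first exact: measurable_box.
    by move=> y Wy i; rewrite -ler_norml; exact: rP.
  by rewrite /leb lebesgue_box// ltry.
pose mu := window_measure mW Woo; pose w := fine (leb R d W).
have wE : lebesgue R d W = w%:E by rewrite /w fineK// ge0_fin_numE.
have w0 : 0 <= w by exact: fine_ge0.
have muT : vol mu setT = w by exact: vol_windowT.
have pp : poisson_process P (intensity gamma_gt0 Q) eta by exact: eta_poisson.
have m_eta B : measurable B -> measurable_fun setT (fun v => eta v B).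
  by move=> mB; exact: (poisson_process_measurable eta_poisson).
have eta_c v : counting_measure (eta v) by exact: (poisson_process_counting eta_poisson).
have [D [mD D_dense]] := separable_measure_algebra mu
  (@measurable_rational_box R d 1) (@rational_box_generates R d 1).
have mC := @measurable_cylinder R d k.
have mCD := measurable_cylinder_setY (k := k) mW Woo.
have FE : F = covered mu eta (@cylinder R d k) setT.
  apply/funext => v; rewrite coveredT; exact: erefl.
have mF : measurable_fun setT F.
  rewrite FE; exact: (measurable_covered m_eta eta_c (@measurable_separating R d k)
    (@separatingP R d k) mC mCD mD D_dense measurableT).
have F_itv v : 0 <= F v <= w.
  rewrite FE -muT; exact: (covered_itv mu eta_c (@measurable_separating R d k)
    (@separatingP R d k) mC setT v).
pose b := A * diam W ^+ k; pose s := gamma * A * w.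
have D0 : 0 <= diam W by exact: diam_ge0.
have b0 : 0 <= b by rewrite mulr_ge0// exprn_ge0.
have mS m := @measurable_bounded_shift R d k A m.
have S_nd := @bounded_shift_nd R d k A.
have nuS m := intensity_bounded_shift gamma_gt0 Q A m.
have nu_out : intensity gamma_gt0 Q (~` \bigcup_m @bounded_shift R d k A m) = 0%E.
  rewrite bigcup_bounded_shift (_ : ~` _ = setT `*`
      [set q | ~ (leb R (d - k) (ncompact_set q.2) <= A%:E)%E]); last first.
    by apply/seteqP; split => -[x q] //= [].
  rewrite /intensity/= /mscale/= product_measure1E//=; last first.
    rewrite (_ : [set q | _] = ~` [set q : SOdk R k * ncompact R (d - k) |
      (leb R (d - k) (ncompact_set q.2) <= A%:E)%E])//.
    by apply: measurableC; exact: measurable_small_mark.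
  by rewrite [X in (_ * (_ * X))%E](mark_volume_le Xi_typical Xi_le) !mule0.
have C_le m p : @bounded_shift R d k A m p -> vol mu (cylinder p) <= b.
  move=> [_ pA]; rewrite -lee_fin volK//.
  apply: le_trans (leb_cylinderI_le p W_compact W_neq0) _.
  by rewrite /b [leRHS]EFinM lee_wpmul2r// lee_fin exprn_ge0.
have C_int m : (\int[intensity gamma_gt0 Q]_(p in @bounded_shift R d k A m)
    (vol mu (cylinder p))%:E <= s%:E)%E.
  apply: (@le_trans _ _ (\int[intensity gamma_gt0 Q]_(p in @small_base R d k A)
    (vol mu (cylinder p))%:E)%E).
    apply: ge0_subset_integral => //.
    - exact: measurable_small_base.
    - apply/measurable_EFinP.
      exact: measurable_funS (measurable_vol_C mCD).
    - by move=> p _; rewrite lee_fin vol_ge0.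
    - by move=> p [].
  apply: le_trans (intensity_mean_volume gamma_gt0 Q mW Woo A0) _.
  by rewrite [leb R d W]wE -EFinM.
split.
  rewrite wE -EFinM; apply: (upper_tail mF F_itv b0 c0 c1 t0) => l l0 lb.
  rewrite FE -muT.
  exact: (poisson_coverage_upper pp (@measurable_separating R d k)
    (@separatingP R d k) mC mCD mD D_dense mS S_nd nuS nu_out b0 C_le l0 lb).
have s0 : 0 <= s by rewrite !mulr_ge0// ltW.
have -> : ((gamma * A ^+ 2 * diam W ^+ k)%:E * lebesgue R d W)%E = (b * s)%:E.
  by rewrite wE -EFinM; congr EFin; rewrite /b /s; ring.
apply: (lower_tail mF F_itv c0 c1 t0); first exact: mulr_ge0.
move=> l l0; rewrite FE.
exact: (poisson_coverage_lower pp (@measurable_separating R d k)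
  (@separatingP R d k) mC mCD mD D_dense mS S_nd nuS nu_out b0 C_le C_int l0).
Qed.
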